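(* Let $\Bbbk$ be an algebraically closed field of characteristic zero, let $H$ be a semisimple Hopf algebra over $\Bbbk$, and let $\tau$ be a Hopf algebra automorphism of $H$ of finite order $r$. Let $V$ be a finite-dimensional left $H$-module with character $\chi$ whose twisted exponent $\exp_\tau(V)$ is finite, and put $d_\tau(V)=r\exp_\tau(V)$. (1) If $m\in r\mathbb N$ is large compared to $d_\tau(V)$, then $\nu_m(\chi,\tau)\in\mathbb Z$. (2) If $d_\tau(V)$ is square-free, then $\nu_m(\chi,\tau)\in\mathbb Z$ for all $m\in r\mathbb N$. In particular, this is the case when $\exp_\tau(H)$ is finite and $d_\tau=r\exp_\tau(H)$ is square-free.
   Context: $\mathbb N$ denotes the positive integers and $r\mathbb N$ the positive multiples of $r$. For $m,d\in\mathbb N$, $m$ is called large compared to $d$ if $d/\gcd(d,m)$ and $m$ are relatively prime. $H$ has comultiplication $\Delta$, counit $\varepsilon$, antipode $S$ (bijective, as $H$ is finite-dimensional); $\Delta^{j-1}(h)=\sum_{(h)}h_1\otimes\cdots\otimes h_j$ is iterated comultiplication in Sweedler notation. Twisted exponent of a module $(V,\rho)$: $\exp_\tau(V)$ is the smallest $k\in\mathbb N$ such that, with $m=kr$ and $\sigma=S^{-2}\tau$, $$\rho\Big(\sum_{(h)}h_1\,\sigma(h_2)\,\sigma^2(h_3)\cdots\sigma^{m-1}(h_{m})\Big)=\varepsilon(h)\,1_V\quad\text{for all }h\in H,$$ and $\infty$ if no such $k$ exists. Twisted exponent of $H$: $\exp_\tau(H)$ is the smallest $k\in\mathbb N$ such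 that, with $m=kr$, $\sum_{(h)}h_1\sigma(h_2)\cdots\sigma^{m-1}(h_m)=\varepsilon(h)1$ for all $h\in H$, and $\infty$ if no such $k$ exists. Twisted Frobenius--Schur indicator: for $m\in r\mathbb N$, $\nu_m(\chi,\tau)=\chi(\tilde\Lambda^{[m]})$, where $\Lambda\in H$ is the unique two-sided integral with $\varepsilon(\Lambda)=1$ and $\tilde h^{[m]}=\sum_{(h)}h_1\tau(h_2)\cdots\tau^{m-1}(h_m)$. *)

(* Defs.v *)
From HB Require Import structures.
From mathcomp Require Import all_boot all_order all_algebra all_field.

Set Implicit Arguments.
Unset Strict Implicit.
Unset Printing Implicit Defensive.

Import GRing.Theory.
Local Open Scope ring_scope.

(* Tensor products of finite-dimensional spaces: U (x) V is the space of
   matrices of coordinates in the products of the chosen bases of U and V. *)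
Section Tensor.
Variable K : fieldType.

Definition tensor (U V : vectType K) : vectType K :=
  'M[K]_(\dim {:U}, \dim {:V}).

Definition pure (U V : vectType K) (u : U) (v : V) : tensor U V :=
  \matrix_(i, j) (coord (vbasis {:U}) i u * coord (vbasis {:V}) j v).

(* The linear map U (x) V -> W induced by a bilinear f : U -> V -> W. *)
Definition tlift (U V W : vectType K) (f : U -> V -> W) : 'Hom(tensor U V, W) :=
  linfun (fun t : 'M[K]_(\dim {:U}, \dim {:V}) =>
    \sum_i \sum_j t i j *: f (vbasis {:U})`_i (vbasis {:V})`_j).

Lemma tliftE (U V W : vectType K) (f : U -> V -> W) (t : tensor U V) :
  tlift f t = \sum_i \sum_j t i j *: f (vbasis {:U})`_i (vbasis {:V})`_j.
Proof.
pose g (t : 'M[K]_(\dim {:U}, \dim {:V})) :=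
  \sum_i \sum_j t i j *: f (vbasis {:U})`_i (vbasis {:V})`_j.
have lin_g : linear g.
  move=> a x y; rewrite /g scaler_sumr -big_split /=.
  apply: eq_bigr => i _; rewrite scaler_sumr -big_split /=.
  by apply: eq_bigr => j _; rewrite !mxE scalerDl scalerA.
pose gL := GRing.isLinear.Build K _ _ _ g lin_g.
pose gl : {linear 'M[K]_(\dim {:U}, \dim {:V}) -> W} := HB.pack g gL.
exact: (lfunE gl t).
Qed.

Lemma tlift_pure (U V W : vectType K) (f : U -> V -> W) :
    (forall v, linear (f^~ v)) -> (forall u, linear (f u)) ->
  forall u v, tlift f (pure u v) = f u v.
Proof.
have lin_sum (X Y : vectType K) (g : X -> Y) : linear g ->
  forall n (c : 'I_n -> K) (x : 'I_n -> X),
  g (\sum_i c i *: x i) = \sum_i c i *: g (x i).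
  move=> lin_g n c x; pose gL := GRing.isLinear.Build K _ _ _ g lin_g.
  pose gl : {linear X -> Y} := HB.pack g gL.
  rewrite -[g (\sum_i _)]/(gl _) linear_sum.
  by apply: eq_bigr => i _; rewrite linearZ_LR.
move=> linl linr u v; rewrite tliftE.
rewrite [in RHS](coord_vbasis (memvf u)) (lin_sum _ _ (f^~ v) (linl v)).
apply: eq_bigr => i _.
rewrite [in RHS](coord_vbasis (memvf v)) (lin_sum _ _ _ (linr _)) scaler_sumr.
by apply: eq_bigr => j _; rewrite mxE scalerA.
Qed.

Definition tmap (U V U' V' : vectType K) (f : U -> U') (g : V -> V') :
    'Hom(tensor U V, tensor U' V') :=
  tlift (fun u v => pure (f u) (g v)).

Definition tassoc (U V W : vectType K) :
    'Hom(tensor (tensor U V) W, tensor U (tensor V W)) :=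
  tlift (fun x w => tlift (fun u v => pure u (pure v w)) x).

Definition tmul (A : falgType K) (x y : tensor A A) : tensor A A :=
  tlift (fun a b => tlift (fun c d => pure (a * c) (b * d)) y) x.

(* tpow V n is the (n+1)-st tensor power V (x) (V (x) ...). *)
Fixpoint tpow (V : vectType K) (n : nat) : vectType K :=
  if n is n'.+1 then tensor V (tpow V n') else V.

End Tensor.

Record hopf_algebra (K : fieldType) (H : falgType K) := HopfAlgebra {
  comul : 'Hom(H, tensor H H);
  counit : 'Hom(H, K^o);
  antipode : 'End(H);
  comulA : forall h, tassoc H H H (tmap comul id (comul h)) =
                     tmap id comul (comul h);
  counitl : forall h, tlift (fun a b => (counit a : K) *: b) (comul h) = h;
  counitr : forall h, tlift (fun a b => (counit b : K) *: a) (comul h) = h;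
  comulM : forall a b, comul (a * b) = tmul (comul a) (comul b);
  comul1 : comul 1 = pure 1 1;
  counitM : forall a b, counit (a * b) = (counit a : K) * (counit b : K);
  counit1 : counit 1 = 1;
  antipodel : forall h,
    tlift (fun a b => antipode a * b) (comul h) = (counit h : K)%:A;
  antipoder : forall h,
    tlift (fun a b => a * antipode b) (comul h) = (counit h : K)%:A
}.

Definition left_ideal (K : fieldType) (A : falgType K) (I : {vspace A}) :=
  forall a x, x \in I -> a * x \in I.

(* The regular module is semisimple: every submodule is a direct summand. *)
Definition semisimple (K : fieldType) (A : falgType K) :=
  forall I : {vspace A}, left_ideal I ->
  exists J : {vspace A},
    [/\ left_ideal J, (I + J)%VS = fullv & (I :&: J)%VS = 0%VS].

(* Values in {1, 2, ...} u {oo}, with None for oo. *)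
Definition least_positive (P : nat -> Prop) (e : option nat) : Prop :=
  if e is Some k then
    [/\ (0 < k)%N, P k & forall j, (0 < j)%N -> P j -> (k <= j)%N]
  else forall j, (0 < j)%N -> ~ P j.

Definition squarefree (n : nat) : Prop :=
  forall p, prime p -> ~~ (p ^ 2 %| n)%N.

Definition large_compared (m d : nat) : bool := coprime (d %/ gcdn d m) m.

Section Twisted.
Variables (K : fieldType) (H : falgType K) (Hs : hopf_algebra H).

Definition hopf_automorphism (tau : 'End(H)) : Prop :=
  [/\ bijective tau,
      tau 1 = 1 /\ {morph tau : a b / a * b},
      forall h, counit Hs (tau h) = counit Hs h,
      forall h, comul Hs (tau h) = tmap tau tau (comul Hs h) &
      forall h, tau (antipode Hs h) = antipode Hs (tau h)].

Definition automorphism_order (tau : 'End(H)) : option nat -> Prop :=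
  least_positive (fun k => forall h, iter k tau h = h).

Fixpoint iter_comul (n : nat) : H -> tpow H n :=
  if n is n'.+1 then fun h => tmap id (iter_comul n') (comul Hs h)
  else fun h => h.

(* h_0 (x) ... (x) h_n |-> sigma^i(h_0) sigma^(i+1)(h_1) ... sigma^(i+n)(h_n) *)
Fixpoint twisted_prod (sigma : H -> H) (i n : nat) : tpow H n -> H :=
  if n is n'.+1 then
    tlift (fun a t => iter i sigma a * twisted_prod sigma i.+1 t)
  else fun a => iter i sigma a.

(* sum h_1 sigma(h_2) ... sigma^(m-1)(h_m), meaningful for m > 0 *)
Definition twisted_power (sigma : H -> H) (m : nat) (h : H) : H :=
  twisted_prod sigma 0 (iter_comul m.-1 h).

(* The antipode is bijective since H is finite-dimensional, so that its lfun
   inverse is a genuine two-sided inverse. *)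
Definition sigma_twist (tau : 'End(H)) : 'End(H) :=
  ((antipode Hs)^-1 \o ((antipode Hs)^-1 \o tau))%VF.

Definition normalized_integral (L : H) : Prop :=
  (forall h, h * L = (counit Hs h : K) *: L /\
             L * h = (counit Hs h : K) *: L) /\
  counit Hs L = 1.

Definition algebra_exponent (tau : 'End(H)) (r : nat) : option nat -> Prop :=
  least_positive (fun k =>
    forall h, twisted_power (sigma_twist tau) (k * r) h = (counit Hs h : K)%:A).

Section Module.
Variable V : vectType K.

Definition representation (rho : 'Hom(H, 'End(V))) : Prop :=
  rho 1 = \1%VF /\ forall a b, rho (a * b) = (rho a \o rho b)%VF.

Definition trace (f : 'End(V)) : K :=
  \tr (passmx.mxof (vbasis {:V}) (vbasis {:V}) f).

Definition character (rho : 'Hom(H, 'End(V))) (h : H) : K := trace (rho h).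

Definition module_exponent (tau : 'End(H)) (r : nat) (rho : 'Hom(H, 'End(V))) :
    option nat -> Prop :=
  least_positive (fun k => forall h,
    rho (twisted_power (sigma_twist tau) (k * r) h) =
    (counit Hs h : K) *: \1%VF).

End Module.

(* L is the normalized integral. *)
Definition indicator (L : H) (m : nat) (chi : H -> K) (tau : 'End(H)) : K :=
  chi (twisted_power tau m L).

End Twisted.

(* Main.v *)
(* Let L be the normalized integral. Everything rests on S^2 = id, the theorem of
   Larson and Radford. Put u = S(L_2) L_1; then S^2 is conjugation by u, and
   chi(u c) = chi(c) for the regular character chi and all central c. The form
   lam = chi(- u^-1) is an integral of the dual with lam(L) = 1, and u S(u) is
   central while u S(u)^-1 is grouplike, hence of finite order, so that some
   power of u is central. Comparing eigenvalues, lam(1) = chi(u^-1) is a sum of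
   terms |z|^2 / k with z a sum of roots of unity and is nonzero. This forces
   S(u) = u, hence S^4 = id. Finally lam(1) = Tr(S^2) is an integral multiple of
   n = dim H because chi * chi = n chi, so Tr(S^2) = n and S^2 = id.

   The indicator nu_m is the trace of L followed by a cyclic shift of period m on
   V (x) V^tau (x) ... (x) V^(tau^(m-1)), hence a sum of m-th roots of unity. On
   the other hand n nu_m is the trace of the m-th power of the operator
   h (x) v |-> tau^-1(h_1) (x) tau^-1(h_2) v of H (x) V, whose d-th power is the
   identity for d = d_tau(V), hence a sum of roots of unity of order dividing
   d / gcd(d, m). If m is coprime to this number, nu_m is rational. *)

(* [K] carries neither an absolute value nor a conjugation. An identity between sums of roots of
   unity in [K] is therefore encoded by an integer polynomial, which vanishes at a primitive root in
   [K] exactly when it vanishes at a primitive root of the same order in [algC]; positivity and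
   Galois arguments take place there. The central power u^N enters through the rule chi(u c) =
   chi(c): for c = u^(-Nk) with k > 0 it gives chi(u^(1-Nk)) = chi(u^(-Nk)), and letting k vary
   separates the eigenvalues d of u^-1 by the value of d^N. Once lam(1) is nonzero, it cancels from
   lam(S x) lam(1) = lam(x) lam(1), whence S(u) = u. An involution of an n-dimensional space whose
   trace is a nonzero integral multiple of n is 1 or -1, and S^2 fixes 1. The shift operator need
   not be invertible, so 0 may join the roots of unity among its eigenvalues. Rationality of nu_m
   suffices, as a sum of roots of unity is an algebraic integer. For the last claim, exp_tau(V)
   divides exp_tau(H). *)
From HB Require Import structures.
Require Import Defs.
From mathcomp Require Import all_boot all_order all_algebra all_field cyclic.
From mathcomp Require Import zify ring.
Set Implicit Arguments.
Unset Strict Implicit.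
Unset Printing Implicit Defensive.
Import GRing.Theory.
Local Open Scope ring_scope.

(** * Traces and eigenvalues *)

Section LinearAlgebra.

Import passmx.

Definition mxpow (R : pzRingType) n (A : 'M[R]_n) k := iter k (mulmx A) 1%:M.

Lemma mxpow_conj (K : fieldType) n (P A : 'M[K]_n) k :
  P \in unitmx -> mxpow (P *m A *m invmx P) k = P *m mxpow A k *m invmx P.
Proof.
move=> Pu; elim: k => [|k IHk]; first by rewrite /mxpow /= mulmx1 mulmxV.
rewrite /mxpow !iterS -!/(mxpow _ _) IHk.
by rewrite !mulmxA mulmxKV.
Qed.

Lemma mxpow_lblock (K : fieldType) n (a : K) (B : 'cV[K]_n) (C : 'M[K]_n) k :
  exists D, mxpow (block_mx a%:M 0 B C) k = block_mx (a ^+ k)%:M 0 D (mxpow C k).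
Proof.
elim: k => [|k [D IHk]].
  by exists 0; rewrite /mxpow /= expr0 scalar_mx_block.
exists (B *m (a ^+ k)%:M + C *m D); rewrite {1}/mxpow iterS -/(mxpow _ _) IHk.
by rewrite mulmx_block !mul0mx !mulmx0 !(addr0, add0r) -scalar_mxM -exprS.
Qed.

(** Deflation: an eigenvector completed to a basis makes the matrix block triangular, and induction
    treats the trailing block. *)
Lemma mx_spectrum (K : closedFieldType) n (A : 'M[K]_n) :
  exists s : seq K, [/\ size s = n,
    forall k, \tr (mxpow A k) = \sum_(c <- s) c ^+ k &
    forall c, c \in s -> eigenvalue A c].
Proof.
elim: n A => [|n IHn] A.
  exists [::]; split=> // k; rewrite big_nil /mxtrace big1 // => i.
  by case: i.
have [a ra] : exists a, root (char_poly A) a.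
  by apply/closed_rootP; rewrite size_char_poly.
have /eigenvalueP[v vA v0] : eigenvalue A a by rewrite eigenvalue_root_char.
pose P : 'M[K]_(1 + n) := row_ebase v.
have Pu : P \in unitmx by apply: row_ebase_unit.
(* The rank factorization of the nonzero row [v] makes the first row of [row_ebase v] proportional
   to [v]. *)
have [b b0 vP] : exists2 b : K, b != 0 & v = b *: row 0 P.
  have := mulmx_ebase v; rewrite (rank_rV v) v0 /= => dv.
  exists ((col_ebase v) 0 0).
    apply: contraNneq v0 => c0; rewrite -dv [col_ebase v]mx11_scalar c0.
    by rewrite mul_scalar_mx scale0r mul0mx.
  rewrite -{1}dv {1}[col_ebase v]mx11_scalar mul_scalar_mx -scalemxAl.
  congr (_ *: _); rewrite rowE; congr (_ *m _).
  by apply/rowP => j; rewrite !mxE andbT eqxx eq_sym.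
have rA : row 0 P *m A = a *: row 0 P.
  by apply: (scalerI b0); rewrite scalemxAl -vP vA {1}vP !scalerA mulrC.
have [B BE] : exists B, B = P *m A *m invmx P by eexists.
have rB : row 0 B = a *: delta_mx 0 0.
  rewrite BE !row_mul rA -scalemxAl -row_mul mulmxV // row1.
  by [].
have [C [D BCD]] : exists C D, B = block_mx (a%:M : 'M_1) 0 C D.
  exists (dlsubmx (B : 'M_(1 + n))), (drsubmx (B : 'M_(1 + n))).
  rewrite -[LHS](@submxK _ 1 n 1 n); congr block_mx.
    apply/matrixP => i j; rewrite !ord1 !mxE.
    have /rowP/(_ 0) := rB; rewrite !mxE !eqxx mulr1 => <-.
    by congr (B _ _); apply: val_inj.
  apply/matrixP => i j; rewrite !ord1 !mxE.
  have /rowP/(_ (rshift 1 j)) := rB; rewrite !mxE !eqxx /= mulr0 => <-.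
  by congr (B _ _); apply: val_inj.
have [s [szs trs eigs]] := IHn D.
have trE k : \tr (mxpow A k) = a ^+ k + \tr (mxpow D k).
  have -> : \tr (mxpow A k) = \tr (mxpow B k).
    by rewrite BE mxpow_conj // mxtrace_mulC mulKmx.
  rewrite BCD; have [E ->] := mxpow_lblock a C D k.
  by rewrite (@mxtrace_block _ 1 n) mxtrace_scalar.
exists (a :: s); split; first by rewrite /= szs.
  by move=> k; rewrite trE big_cons trs.
have eigB c : eigenvalue B c -> eigenvalue A c.
  move=> /eigenvalueP[w wB w0]; apply/eigenvalueP; exists (w *m P).
    by rewrite scalemxAl -wB BE -!mulmxA mulVmx // mulmx1.
  apply: contraNneq w0 => wP0.
  by rewrite -[w](mulmxK Pu) wP0 mul0mx.
move=> c; rewrite inE => /predU1P[->|cs].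
  by rewrite eigenvalue_root_char.
have [->|ca] := eqVneq c a; first by rewrite eigenvalue_root_char.
have /eigenvalueP[w wD w0] := eigs c cs.
apply: eigB; apply/eigenvalueP.
(* An eigenvector of the trailing block extends to [B] by solving for the first coordinate, which
   needs c different from a. *)
exists (row_mx (((c - a)^-1) *: (w *m C)) w : 'rV_(1 + n)).
  rewrite BCD (mul_row_block _ w) mulmx0 add0r wD scale_row_mx; congr row_mx.
  have ca0 : c - a != 0 by rewrite subr_eq0.
  rewrite mul_mx_scalar scalerA -[X in _ + X](scalerK ca0) !scalerA.
  by rewrite -scalerDl [a * _]mulrC -mulrDr [a + _]addrC subrK mulrC.
by apply: contraNneq w0 => /(congr1 (@rsubmx _ 1 1 n)); rewrite row_mxKr linear0 => ->.
Qed.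

Section LfunTrace.
Variables (K : fieldType) (V : vectType K).
Implicit Types f g : 'End(V).

Local Notation e := (vbasis {:V}).
Let e_basis : basis_of {:V} e := vbasisP fullv.
Let e_free : free e := basis_free e_basis.

Lemma traceE f : trace f = \sum_i coord e i (f e`_i).
Proof.
rewrite /trace /mxtrace; apply: eq_bigr => i _.
by rewrite !mxE /= passmx.vecof_delta.
Qed.

Lemma trace_is_linear : linear (@trace K V : 'End(V) -> K^o).
Proof. by move=> a f g; rewrite /trace passmx.mxof_linear mxtraceD mxtraceZ. Qed.

Lemma trace_compC f g : trace (f \o g)%VF = trace (g \o f)%VF.
Proof. by rewrite /trace !(@passmx.mxof_comp _ _ _ _ e e e e_basis) mxtrace_mulC. Qed.

(** The [phi k] and [v k] need not be dual bases: any presentation of [f] in V^* (x) V gives its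
    trace. *)
Lemma trace_rank_one (I : finType) f (phi : I -> V -> K^o) (v : I -> V) :
    (forall k, linear (phi k)) -> (forall x, f x = \sum_k phi k x *: v k) ->
  trace f = \sum_k phi k (v k).
Proof.
move=> lin_phi fE; rewrite traceE.
under eq_bigr => i _ do rewrite fE linear_sum.
rewrite exchange_big /=; apply: eq_bigr => k _.
pose pL := GRing.isLinear.Build K V K^o _ (phi k) (lin_phi k).
pose p : {linear V -> K^o} := HB.pack (phi k) pL.
rewrite -![phi k _]/(p _) [in RHS](coord_vbasis (memvf (v k))) linear_sum.
apply: eq_bigr => i _; rewrite !linearZ /= -![phi k _]/(p _).
by rewrite mulrC.
Qed.

(** Composition on the right matches [mxpow], since [mxof] reverses composition. *)
Definition lfpow f k : 'End(V) := iter k (fun g => g \o f)%VF \1%VF.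

Lemma lfpowE f k x : lfpow f k x = iter k f x.
Proof.
elim: k x => [|k IHk] x; first by rewrite /= id_lfunE.
by rewrite /lfpow iterS iterSr comp_lfunE -/(lfpow f k) IHk.
Qed.

Lemma mxof_lfpow f k : passmx.mxof e e (lfpow f k) = mxpow (passmx.mxof e e f) k.
Proof.
elim: k => [|k IHk]; first exact: passmx.mxof1.
rewrite /lfpow /mxpow !iterS -/(lfpow f k) -/(mxpow _ k).
by rewrite (@passmx.mxof_comp _ _ _ _ e e e e_basis) IHk.
Qed.

Lemma trace_idempotent f :
  (forall x, f (f x) = f x) -> trace f = (\dim (limg f))%:R.
Proof.
move=> ff; pose b := vbasis (limg f).
have bf : free b by apply: basis_free (vbasisP _).
have lin_phi (k : 'I_(\dim (limg f))) : linear (fun x => coord b k (f x) : K^o).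
  by move=> a x y; rewrite !linearP.
rewrite (trace_rank_one lin_phi (v := fun k : 'I__ => b`_k)) => [|x]; last first.
  exact: (coord_vbasis (memv_img f (memvf x))).
rewrite -[X in X%:R]card_ord -sumr_const; apply: eq_bigr => k _.
have /memv_imgP[y _ bE] : b`_k \in limg f.
  by apply: vbasis_mem; apply: mem_nth; rewrite size_tuple.
by rewrite bE ff -bE coord_free // eqxx.
Qed.

End LfunTrace.

(** In characteristic zero the trace of an idempotent determines its rank. *)
Lemma idempotent_trace0 (K : fieldType) (V : vectType K) (f : 'End(V)) :
  [pchar K] =i pred0 -> (forall x, f (f x) = f x) -> trace f = 0 -> f = 0.
Proof.
move=> /pcharf0P char0 ff /eqP; rewrite trace_idempotent // char0 dimv_eq0.
move=> /eqP f0; apply/lfunP => x; rewrite zero_lfunE; apply/eqP.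
by rewrite -memv0 -f0 memv_img ?memvf.
Qed.

Lemma lfun_spectrum (K : closedFieldType) (V : vectType K) (f : 'End(V)) :
  exists s : seq K, [/\ size s = \dim {:V},
    forall k, trace (lfpow f k) = \sum_(c <- s) c ^+ k &
    forall c, c \in s -> exists2 v, v != 0 & f v = c *: v].
Proof.
have e_basis : basis_of {:V} (vbasis {:V}) := vbasisP fullv.
pose M := passmx.mxof (vbasis {:V}) (vbasis {:V}) f.
have [s [szs trs eigs]] := mx_spectrum M.
exists s; split=> // [k|c /eigs/eigenvalueP[w wM w0]].
  rewrite -trs /trace; congr (\tr _).
  exact: mxof_lfpow.
exists (passmx.vecof (vbasis {:V}) w); first by rewrite passmx.vecof_eq0.
by rewrite (passmx.hom_vecof _ e_basis) -/M wM linearZ.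
Qed.

End LinearAlgebra.

(** * Sums of roots of unity *)

Section Cyclotomic.

Import Order.TTheory Num.Theory.
Local Notation pZ R := (map_poly (intr : int -> R)).

(** * Integer relations between roots of unity, from [K] to the complex numbers *)

Section Transfer.
Variables (K : fieldType) (charK : [pchar K] =i pred0).

Lemma char0_intr_eq0 (a : int) : (a%:~R == 0 :> K) = (a == 0).
Proof.
have /pcharf0P char0 := charK.
by case: a => n; rewrite ?NegzE ?rmorphN ?oppr_eq0 ?intr_nat /= -[_%:~R]/(_%:R) char0.
Qed.

(** ['X^M - 1] is the product of the ['Phi_d] for d dividing M, and the order of a root of ['Phi_d]
    divides d. *)
Lemma root_Cyclotomic_prim M (zeta : K) :
  M.-primitive_root zeta -> root (pZ K 'Phi_M) zeta.
Proof.
move=> zP; have M0 := prim_order_gt0 zP.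
have : root (pZ K ('X^M - 1)) zeta.
  rewrite rmorphB rmorph1 /= map_polyXn rootE !hornerE.
  by rewrite prim_expr_order // subrr.
rewrite -prod_Cyclotomic // rmorph_prod rootE horner_prod prodf_seq_eq0.
move=> /hasP[d dM /= rd].
suff -> : M = d by [].
have d0 : (0 < d)%N by move: dM; rewrite -dvdn_divisors // => /dvdn_gt0->.
apply/eqP; rewrite eqn_dvd -dvdn_divisors // in dM *.
rewrite dM andbT (prim_order_dvd zP).
have : root (pZ K ('X^d - 1)) zeta.
  rewrite -prod_Cyclotomic // (bigD1_seq d) ?divisors_uniq -?dvdn_divisors //=.
  by rewrite rmorphM rootM !rootE rd.
by rewrite rmorphB rmorph1 /= map_polyXn rootE !hornerE subr_eq0.
Qed.

Lemma minCpoly_Cyclotomic M (omega : algC) (q : {poly rat}) :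
  M.-primitive_root omega -> minCpoly omega = map_poly ratr q -> q = pZ rat 'Phi_M.
Proof.
move=> wP qE; apply: (map_poly_inj (ratr : {rmorphism rat -> algC})).
rewrite -qE (minCpoly_cyclotomic wP) -(Cintr_Cyclotomic wP) -map_poly_comp.
by apply: eq_map_poly => a; rewrite /= ratr_int.
Qed.

Lemma root_pZ (p : {poly int}) (x : algC) :
  root (pZ algC p) x = root (map_poly ratr (pZ rat p)) x.
Proof.
congr (root _ x); rewrite -map_poly_comp.
by apply: eq_map_poly => a; rewrite /= ratr_int.
Qed.

(** As ['Phi_M] is the minimal polynomial of [omega], it divides [p] or is coprime to it. Either
    fact is a polynomial identity which, freed of denominators, can be evaluated at [zeta]. *)
Lemma root_primitive M (zeta : K) (omega : algC) (p : {poly int}) :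
    M.-primitive_root zeta -> M.-primitive_root omega ->
  root (pZ K p) zeta = root (pZ algC p) omega.
Proof.
move=> zP wP; have Phiz := root_Cyclotomic_prim zP.
have [q [qE qm] qP] := minCpolyP omega.
have qPhi := minCpoly_Cyclotomic wP qE.
have Zinj : injective (pZ rat).
  by apply: map_inj_poly => //; apply: intr_inj.
rewrite root_pZ qP; apply/idP/idP => [pz|/dvdpP[r pE]].
  apply: contraLR pz => qp.
  have cop : coprimep q (pZ rat p).
    have /dvdpP[h hE] := dvdp_gcdl q (pZ rat p).
    have : root (map_poly ratr q) omega by rewrite qP.
    rewrite {1}hE rmorphM rootM !qP => /orP[qh|/dvdp_trans /(_ (dvdp_gcdr _ _))]; last first.
      by rewrite (negPf qp).
    have q0 : q != 0 by apply: monic_neq0.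
    have h0 : h != 0 by apply: contraNneq q0 => h0; rewrite hE h0 mul0r.
    have g0 : gcdp q (pZ rat p) != 0 by apply: contraNneq q0 => g0; rewrite hE g0 mulr0.
    have := dvdp_leq h0 qh; rewrite {1}hE size_mul // => le_hg.
    rewrite coprimep_def eqn_leq size_poly_gt0 g0 andbT leqNgt.
    apply/negP => g1; move: le_hg; rewrite leqNgt => /negP[].
    by case: (size (gcdp _ _)) g1 => [|[|b]] // _; rewrite !addnS ltnS leq_addr.
  have /Bezout_eq1_coprimepP[[a b] /= E] := cop.
  have [a' [s s0 aE]] := rat_poly_scale a.
  have [b' [t t0 bE]] := rat_poly_scale b.
  (* The Bezout identity with denominators cleared; its constant s t stays nonzero in [K]. *)
  have E2 : t *: (a' * 'Phi_M) + s *: (b' * p) = (s * t)%:P. 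
    have s0' : s%:~R != 0 :> rat by rewrite ssrint.intr_eq0.
    have t0' : t%:~R != 0 :> rat by rewrite ssrint.intr_eq0.
    have Ea : pZ rat a' = s%:~R *: a by rewrite aE scalerA mulfV ?scale1r.
    have Eb : pZ rat b' = t%:~R *: b by rewrite bE scalerA mulfV ?scale1r.
    apply: Zinj; rewrite rmorphD /= !map_polyZ /= 2!rmorphM /= map_polyC /= intrM.
    rewrite Ea Eb -qPhi -!scalerAl !scalerA [t%:~R * _]mulrC -scalerDr E.
    by rewrite alg_polyC.
  apply: contraNN s0 => pz.
  have /(congr1 (fun f => (pZ K f).[zeta])) := E2.
  rewrite rmorphD /= !map_polyZ 2!rmorphM /= map_polyC /= hornerD !hornerZ.
  rewrite !hornerM hornerC (rootP pz) (rootP Phiz) !mulr0 addr0 => /esym/eqP.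
  by rewrite char0_intr_eq0 mulf_eq0 (negPf t0) orbF.
have [r' [s s0 rE]] := rat_poly_scale r.
have E : s *: p = r' * 'Phi_M.
  apply: Zinj; rewrite map_polyZ rmorphM /= pE rE qPhi -scalerAl scalerA mulfV ?scale1r //.
  by rewrite ssrint.intr_eq0.
have /(congr1 (fun f => (pZ K f).[zeta])) := E.
rewrite map_polyZ rmorphM /= hornerZ hornerM (rootP Phiz) mulr0 => /eqP.
by rewrite mulf_eq0 char0_intr_eq0 (negPf s0) /= rootE.
Qed.

End Transfer.

Lemma prim_root_exists (K : closedFieldType) n :
  [pchar K] =i pred0 -> (0 < n)%N -> exists z : K, n.-primitive_root z.
Proof.
move=> /pcharf0P char0 n_gt0.
pose p : {poly K} := 'X^n - 1; have [r Dp] := closed_field_poly_normal p.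
rewrite (monicP _) ?monicXnsubC // scale1r in Dp.
have rn1 : all n.-unity_root r by apply/allP=> z; rewrite -root_prod_XsubC -Dp.
have sz_r : (n < (size r).+1)%N.
  by rewrite -(size_prod_XsubC r id) -Dp size_XnsubC.
have [|z] := hasP (has_prim_root n_gt0 rn1 _ sz_r); last by exists z.
by rewrite -separable_prod_XsubC -Dp separable_Xn_sub_1 // char0 -lt0n.
Qed.

(* Over the complex numbers the two inner sums are complex conjugate. *)
Lemma sum_conj_eq0 (K : fieldType) (charK : [pchar K] =i pred0) (I : finType)
    (p : I -> I) (k c : I -> nat) N (zeta : K) :
    N.-primitive_root zeta -> (forall j, 0 < c j)%N ->
    \sum_j (c j)%:R * (\sum_(i | p i == j) zeta ^+ k i) *
      (\sum_(i | p i == j) zeta ^+ (N.-1 * k i)) = 0 ->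
  forall j, \sum_(i | p i == j) zeta ^+ (N.-1 * k i) = 0.
Proof.
move=> zP c0 sum0 j.
have N0 := prim_order_gt0 zP; have [omega wP] := C_prim_root_exists N0.
pose A j : {poly int} := \sum_(i | p i == j) 'X^(k i).
pose B j : {poly int} := \sum_(i | p i == j) 'X^(N.-1 * k i).
have AE (R : comNzRingType) (x : R) i : (pZ R (A i)).[x] = \sum_(l | p l == i) x ^+ k l.
  by rewrite rmorph_sum horner_sum; apply: eq_bigr => l _; rewrite /= map_polyXn hornerXn.
have BE (R : comNzRingType) (x : R) i : (pZ R (B i)).[x] = \sum_(l | p l == i) x ^+ (N.-1 * k l).
  by rewrite rmorph_sum horner_sum; apply: eq_bigr => l _; rewrite /= map_polyXn hornerXn.
pose P := \sum_j (c j)%:R * A j * B j.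
have PE (R : comNzRingType) (x : R) : (pZ R P).[x] =
    \sum_j (c j)%:R * (pZ R (A j)).[x] * (pZ R (B j)).[x].
  rewrite rmorph_sum horner_sum; apply: eq_bigr => l _.
  by rewrite !rmorphM /= rmorph_nat !hornerM -[_%:R]polyC_natr hornerC.
have rP : root (pZ K P) zeta.
  by rewrite rootE PE; apply/eqP; rewrite -[RHS]sum0; apply: eq_bigr => l _; rewrite AE BE.
have norm_w : `|omega| = 1.
  by apply/eqP; rewrite -(pexpr_eq1 N0) ?normr_ge0 // -normrX prim_expr_order // normr1.
(* [omega ^+ N.-1] is the inverse of [omega], hence its conjugate. *)
have BA i : (pZ algC (B i)).[omega] = ((pZ algC (A i)).[omega])^*.
  rewrite AE BE rmorph_sum; apply: eq_bigr => l _.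
  rewrite rmorphXn /= exprM; congr (_ ^+ _).
  have w0 : omega != 0 by rewrite -normr_eq0 norm_w oner_eq0.
  apply: (mulfI w0); rewrite -exprS prednK // prim_expr_order //.
  by rewrite -normCK norm_w expr1n.
have : root (pZ algC P) omega by rewrite -(root_primitive charK P zP wP).
rewrite rootE PE psumr_eq0 => [/allP/(_ j)|l _]; last first.
  by rewrite BA -mulrA -normCK mulr_ge0 ?ler0n ?exprn_ge0.
rewrite mem_index_enum /= => /(_ isT).
rewrite !mulf_eq0 pnatr_eq0 -leqn0 leqNgt c0 /= => AB0.
have : root (pZ algC (B j)) omega.
  by rewrite rootE; case/orP: AB0 => // /eqP A0; rewrite BA A0 rmorph0.
by rewrite -(root_primitive charK (B j) zP wP) rootE BE => /eqP.
Qed.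

(** Equal moments integrate every polynomial equally; test with the one that vanishes at all the
    values [y i] other than z. *)
Lemma sum_fiber_powers (K : fieldType) n (y a b : 'I_n -> K) :
    (forall k, \sum_i a i * y i ^+ k = \sum_i b i * y i ^+ k) ->
  forall z, \sum_(i | y i == z) a i = \sum_(i | y i == z) b i.
Proof.
move=> abE z.
have abq (q : {poly K}) : \sum_i a i * q.[y i] = \sum_i b i * q.[y i].
  under eq_bigr => i _ do rewrite horner_coef mulr_sumr.
  under [RHS]eq_bigr => i _ do rewrite horner_coef mulr_sumr.
  rewrite exchange_big [RHS]exchange_big /=; apply: eq_bigr => k _.
  under eq_bigr => i _ do rewrite mulrCA.
  under [RHS]eq_bigr => i _ do rewrite mulrCA.
  by rewrite -!mulr_sumr abE.
pose q := \prod_(i | y i != z) ('X - (y i)%:P).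
have qz : q.[z] != 0.
  rewrite horner_prod; apply/prodf_neq0 => i yi.
  by rewrite hornerXsubC subr_eq0 eq_sym.
have sumq c : \sum_i c i * q.[y i] = (\sum_(i | y i == z) c i) * q.[z].
  rewrite (bigID (fun i => y i == z)) /= [X in _ + X]big1 ?addr0 => [|i yi].
    by rewrite mulr_suml; apply: eq_bigr => i /eqP->.
  by rewrite horner_prod (bigD1 i) //= hornerXsubC subrr mul0r mulr0.
by apply: (mulIf qz); rewrite -!sumq abq.
Qed.

(* If t^N = d^N, the hypothesis says that t n_d is the sum of the (t / d') over
   the n_d indices with d'^N = d^N, so that the sum of the d' in this class is
   |sum of the (d' / t)|^2 / n_d when read in the complex numbers. *)
Lemma eigenvalue_sum_neq0 (K : closedFieldType) (charK : [pchar K] =i pred0)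
    n (d : 'I_n -> K) N :
    (0 < n)%N -> (0 < N)%N -> (forall i, d i != 0) ->
    (forall k, \sum_i d i ^+ N.-1 * (d i ^+ N) ^+ k =
               \sum_i d i ^+ N * (d i ^+ N) ^+ k) ->
  \sum_i d i != 0.
Proof.
move=> n0 N0 d0 dE; have /pcharf0P char0 := charK.
have fiber := sum_fiber_powers dE.
have rt_ex (y : K) : exists t, t ^+ N == y.
  have : size ('X^N - y%:P) != 1%N by rewrite size_XnsubC // eqSS -lt0n.
  by move=> /closed_rootP[t]; rewrite rootE !hornerE subr_eq0; exists t.
pose rt y := xchoose (rt_ex y).
have rtE y : rt y ^+ N = y by apply/eqP; exact: (xchooseP (rt_ex y)).
pose t i := rt (d i ^+ N); have tE i : t i ^+ N = d i ^+ N by apply: rtE.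
have t0 i : t i != 0.
  apply: contraNN (d0 i) => /eqP ti; have /eqP := tE i.
  by rewrite ti expr0n gtn_eqF //= eq_sym expf_eq0 N0.
have [zeta zP] := prim_root_exists charK N0.
have /fin_all_exists[k kE] i : exists k : nat, d i = t i * zeta ^+ k.
  have /(prim_rootP zP)[k kE] : (d i / t i) ^+ N = 1.
    by rewrite expr_div_n -tE divff // expf_neq0.
  by exists k; rewrite -kE mulrC divfK.
(* A representative of the class of i; the default is never reached, since i itself qualifies. *)
pose p i := odflt i [pick j | d j ^+ N == d i ^+ N].
have pE i : d (p i) ^+ N = d i ^+ N.
  by rewrite /p; case: pickP => // j /eqP.
have pP i j : (p i == p j) = (d i ^+ N == d j ^+ N).
  apply/eqP/eqP => [E|E]; first by rewrite -pE E pE.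
  rewrite /p (@eq_pick _ _ (fun l => d l ^+ N == d j ^+ N)) => [|l]; last by rewrite E.
  by case: pickP => // /(_ j); rewrite eqxx.
pose nn j := #|[pred i | p i == j]|.
(* The factorial clears the weights 1 / n_d; [maxn 1] covers the indices j that represent no
   class. *)
pose c j := (n`! %/ maxn 1 (nn j))%N.
have nn_le j : (nn j <= n)%N by rewrite -[X in (_ <= X)%N]card_ord max_card.
have c_nn j : (c j * maxn 1 (nn j))%N = n`!.
  rewrite divnK // dvdn_fact // leq_max /= geq_max n0 nn_le.
  by [].
have c0 j : (0 < c j)%N.
  by rewrite lt0n; apply: contraTneq (fact_gt0 n) => cj; rewrite -(c_nn j) cj.
pose A j := \sum_(i | p i == j) zeta ^+ k i.
pose B j := \sum_(i | p i == j) zeta ^+ (N.-1 * k i).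
(* On one class the hypothesis reads: the sum of the d^(N-1) is n_d t^N. Divide by t^(N-1). *)
have BE i0 : B (p i0) = (nn (p i0))%:R * t i0.
  have tc i : p i == p i0 -> t i = t i0 by rewrite pP /t => /eqP->.
  have tN0 : t i0 ^+ N.-1 != 0 by rewrite expf_neq0.
  apply: (mulfI tN0); rewrite mulrCA -exprSr prednK // mulr_sumr.
  have := fiber (d i0 ^+ N); rewrite -(eq_bigl _ _ (fun i => pP i i0)) => E.
  transitivity (\sum_(i | p i == p i0) d i ^+ N.-1).
    by apply: eq_bigr => i /tc ti; rewrite kE exprMn ti -exprM [(k i * _)%N]mulnC.
  rewrite E [RHS]mulr_natl -sumr_const.
  apply: eq_big => [i|i]; first by rewrite inE pP.
  by rewrite tE => /eqP.
apply/eqP => sum0.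
have cE j : \sum_(i | p i == j) d i * n`!%:R = (c j)%:R * A j * B j.
  have [i0 /eqP pi0|nop] := pickP [pred i | p i == j]; last first.
    by rewrite /A !big_pred0 // mulr0 mul0r.
  have tc i : p i == j -> t i = t i0 by rewrite -pi0 pP /t => /eqP->.
  have nj : (0 < nn j)%N by apply/card_gt0P; exists i0; rewrite inE pi0 eqxx.
  rewrite -mulr_suml.
  have -> : \sum_(i | p i == j) d i = \sum_(i | p i == j) t i0 * zeta ^+ k i.
    by apply: eq_bigr => i /tc ti; rewrite kE ti.
  rewrite -mulr_sumr -/(A j) -(c_nn j) (maxn_idPr nj) natrM -pi0 BE.
  by rewrite [t i0 * A _]mulrC -!mulrA [t i0 * _]mulrC -!mulrA mulrCA.
have B0 : forall j, B j = 0.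
  apply: (sum_conj_eq0 charK zP c0).
  have : (\sum_i d i) * n`!%:R = 0 by rewrite sum0 mul0r.
  rewrite mulr_suml (partition_big p predT) //= => E.
  by rewrite -[RHS]E; apply: eq_bigr => j _; rewrite cE.
pose i0 := Ordinal n0; have /eqP := B0 (p i0).
rewrite BE mulf_eq0 (negPf (t0 i0)) orbF char0 -leqn0 leqNgt => /negP[].
by apply/card_gt0P; exists i0; rewrite inE.
Qed.

Lemma horner_sum_Xn (R : comNzRingType) (s : seq nat) (x : R) :
  (pZ R (\sum_(k <- s) 'X^k)).[x] = \sum_(k <- s) x ^+ k.
Proof.
rewrite rmorph_sum horner_sum; apply: eq_bigr => k _.
by rewrite /= map_polyXn hornerXn.
Qed.

(* Modulo the minimal polynomial of [omega], [P - x] has degree less than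
   [totient M] but all the conjugates of [omega] as roots. *)
Lemma rational_of_conjugates M (omega x : algC) (P : {poly int}) :
    M.-primitive_root omega ->
    (forall k, coprime k M -> (pZ algC P).[omega ^+ k] = x) ->
  x \in Crat.
Proof.
move=> wP xE; have M0 := prim_order_gt0 wP.
pose Phi := pZ rat 'Phi_M; pose R := pZ rat P %% Phi.
have PhiE : map_poly ratr Phi = cyclotomic omega M.
  rewrite -(Cintr_Cyclotomic wP) /Phi -map_poly_comp.
  by apply: eq_map_poly => a; rewrite /= ratr_int.
have szPhi : size Phi = (totient M).+1.
  by rewrite -(size_map_poly (ratr : {rmorphism rat -> algC})) PhiE size_cyclotomic.
have Phi0 : Phi != 0 by rewrite -size_poly_gt0 szPhi.
have szR : (size R < (totient M).+1)%N by rewrite -szPhi ltn_modp.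
pose Q : {poly algC} := map_poly ratr R - x%:P.
suff Q0 : Q = 0.
  have /eqP := congr1 (fun q : {poly algC} => q`_0) Q0.
  rewrite coefB coef_map coefC coef0 subr_eq0 => /eqP <-.
  exact: Crat_rat.
have szQ : (size Q <= totient M)%N.
  rewrite (leq_trans (size_polyD _ _)) // geq_max size_map_poly -ltnS szR /=.
  by rewrite size_polyN (leq_trans (size_polyC_leq1 _)) // totient_gt0.
apply/eqP; apply: contraLR szQ => Q0; rewrite -ltnNge.
have : cyclotomic omega M %| Q.
  rewrite /cyclotomic -big_filter -(big_map (fun k : 'I_M => omega ^+ k) predT (fun z => 'X - z%:P)).
  rewrite uniq_roots_dvdp //; last first.
    rewrite uniq_rootsE map_inj_in_uniq ?filter_uniq ?index_enum_uniq // => i j _ _ /eqP.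
    by rewrite (eq_prim_root_expr wP) !modn_small // => /eqP/val_inj.
  apply/allP => z /mapP[k]; rewrite mem_filter => /andP[ck _] ->.
  have := xE k ck.
  have PE : pZ algC P = map_poly ratr (pZ rat P %/ Phi) * cyclotomic omega M + map_poly ratr R.
    rewrite -PhiE -rmorphM -rmorphD -divp_eq /= -map_poly_comp.
    by apply: eq_map_poly => a; rewrite /= ratr_int.
  rewrite PE hornerD hornerM.
  have /rootP -> : root (cyclotomic omega M) (omega ^+ k).
    by rewrite root_cyclotomic // prim_root_exp_coprime.
  rewrite mulr0 add0r => RE.
  by rewrite rootE hornerD hornerN hornerC RE subrr.
by move/(dvdp_leq Q0); rewrite size_cyclotomic.
Qed.

(** For m and e coprime, the m-th and the e-th cyclotomic fields meet in the rationals, and x is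
    moreover an algebraic integer. *)
Lemma sum_unity_roots_int (K : closedFieldType) (charK : [pchar K] =i pred0)
    (m e n : nat) (x : K) (s t : seq K) :
    (0 < m)%N -> (0 < e)%N -> (0 < n)%N -> coprime m e ->
    (forall a, a \in s -> a = 0 \/ a ^+ m = 1) ->
    (forall b, b \in t -> b ^+ e = 1) ->
    x = \sum_(a <- s) a -> n%:R * x = \sum_(b <- t) b ->
  exists z : int, x = z%:~R.
Proof.
move=> m0 e0 n0 co_me sP tP xs xt.
have M0 : (0 < m * e)%N by rewrite muln_gt0 m0.
have [zeta zP] := prim_root_exists charK M0.
have [omega wP] := C_prim_root_exists M0.
have zem : m.-primitive_root (zeta ^+ e).
  have -> : m = (m * e %/ gcdn e (m * e))%N by rewrite gcdnMl ?gcdnC mulnK.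
  exact: exp_prim_root.
have zme : e.-primitive_root (zeta ^+ m).
  have -> : e = (m * e %/ gcdn m (m * e))%N by rewrite gcdnMr mulKn.
  exact: exp_prim_root.
have [js xjs] : exists js : seq nat, x = \sum_(j <- js) zeta ^+ (e * j).
  rewrite xs; elim: s sP {xs} => [|a s IHs] sP; first by exists [::]; rewrite !big_nil.
  have [js jsE] : exists js : seq nat, \sum_(a <- s) a = \sum_(j <- js) zeta ^+ (e * j).
    by apply: IHs => b bs; apply: sP; rewrite inE bs orbT.
  have [->|am] := sP a (mem_head _ _); first by exists js; rewrite big_cons add0r.
  have [j aj] := prim_rootP zem am.
  by exists ((j : nat) :: js); rewrite !big_cons jsE aj exprM.
have [ks xks] : exists ks : seq nat, n%:R * x = \sum_(k <- ks) zeta ^+ (m * k).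
  rewrite xt; elim: t tP {xt} => [|a l IHl] tP; first by exists [::]; rewrite !big_nil.
  have [ks' ks'E] : exists ks' : seq nat, \sum_(a <- l) a = \sum_(j <- ks') zeta ^+ (m * j).
    by apply: IHl => b bs; apply: tP; rewrite inE bs orbT.
  have [j aj] := prim_rootP zme (tP a (mem_head _ _)).
  by exists ((j : nat) :: ks'); rewrite !big_cons ks'E aj exprM.
pose P : {poly int} := \sum_(k <- [seq (e * j)%N | j <- js]) 'X^k.
pose Q : {poly int} := \sum_(k <- [seq (m * j)%N | j <- ks]) 'X^k.
have PE (R : comNzRingType) (y : R) : (pZ R P).[y] = \sum_(j <- js) y ^+ (e * j).
  by rewrite horner_sum_Xn big_map.
have QE (R : comNzRingType) (y : R) : (pZ R Q).[y] = \sum_(j <- ks) y ^+ (m * j).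
  by rewrite horner_sum_Xn big_map.
pose xC : algC := (pZ algC P).[omega].
have nP : n%:R * xC = (pZ algC Q).[omega].
  pose D := n%:R * P - Q.
  have DE (R : comNzRingType) (y : R) : (pZ R D).[y] = n%:R * (pZ R P).[y] - (pZ R Q).[y].
    by rewrite rmorphB rmorphM /= rmorph_nat hornerD hornerN hornerM -[_%:R]polyC_natr hornerC.
  have : root (pZ K D) zeta by rewrite rootE DE PE QE -xjs -xks subrr.
  by rewrite (root_primitive charK D zP wP) rootE DE subr_eq0 => /eqP.
have xCrat : xC \in Crat.
  apply: (rational_of_conjugates (P := P) wP) => k ck.
  (* Raising roots of unity to the power [k1] fixes the e-th ones, hence x, but acts as the power k
     on the m-th ones; so all conjugates of x are equal. *)
  pose k1 := chinese m e k 1.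
  have k1m : k1 = k %[mod m] by apply: chinese_modl.
  have k1e : k1 = 1 %[mod e] by apply: chinese_modr.
  have ck1 : coprime k1 (m * e).
    rewrite coprimeMr -coprime_modl k1m coprime_modl -[coprime k1 e]coprime_modl k1e coprime_modl.
    by rewrite coprime1n andbT; move: ck; rewrite coprimeMr => /andP[].
  have [nu nuE] := Qn_aut_exists ck1.
  have nuw : nu omega = omega ^+ k1 by rewrite nuE // prim_expr_order.
  have nuP (F : {poly int}) : nu (pZ algC F).[omega] = (pZ algC F).[omega ^+ k1].
    rewrite -horner_map nuw -map_poly_comp; congr (_.[_]).
    by apply: eq_map_poly => a; rewrite /= rmorph_int.
  have nuxC : nu xC = xC.
    apply: (@mulfI _ n%:R); first by rewrite pnatr_eq0 -lt0n.
    rewrite nP -{1}(rmorph_nat nu n) -rmorphM nP nuP !QE.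
    apply: eq_bigr => j _; apply/eqP; rewrite -exprM (eq_prim_root_expr wP).
    by rewrite mulnCA -!muln_modr -modnMml k1e modnMml mul1n.
  rewrite -nuxC /xC nuP !PE; apply: eq_bigr => j _; apply/eqP.
  rewrite -!exprM (eq_prim_root_expr wP) mulnCA [(k1 * _)%N]mulnCA [(m * e)%N]mulnC.
  by rewrite -!muln_modr -modnMml -k1m modnMml.
have xCint : xC \in Num.int.
  apply: Cint_rat_Aint => //; rewrite /xC PE; apply: rpred_sum => j _.
  by apply: rpredX; apply: Aint_prim_root wP.
have /intrP[z xz] := xCint.
exists z.
have : root (pZ algC (P - z%:P)) omega.
  by rewrite rootE rmorphB /= map_polyC hornerD hornerN hornerC -/xC xz subrr.
rewrite -(root_primitive charK _ zP wP) rootE rmorphB /= map_polyC hornerD hornerN hornerC.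
by rewrite PE -xjs subr_eq0 => /eqP.
Qed.

End Cyclotomic.

(** * Sweedler calculus *)

Section Lin.
Variables (K : fieldType).

Lemma lin_id (U : lmodType K) : linear (fun x : U => x).
Proof. by []. Qed.

Lemma lin_lfun (T U V : vectType K) (F : 'Hom(U, V)) (g : T -> U) :
  linear g -> linear (fun x => F (g x)).
Proof. by move=> lg a x y; rewrite lg linearP. Qed.

Lemma lin_app (T : lmodType K) (U V W : vectType K) (F : 'Hom(U, 'Hom(V, W)))
    (g : T -> U) v :
  linear g -> linear (fun x => F (g x) v).
Proof. by move=> lg a x y; rewrite lg linearP add_lfunE scale_lfunE. Qed.

Lemma lin_mull (T : lmodType K) (A : falgType K) a (g : T -> A) :
  linear g -> linear (fun x => a * g x).
Proof. by move=> lg c x y; rewrite lg mulrDr scalerAr. Qed.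

Lemma lin_mulr (T : lmodType K) (A : falgType K) a (g : T -> A) :
  linear g -> linear (fun x => g x * a).
Proof. by move=> lg c x y; rewrite lg mulrDl scalerAl. Qed.

Lemma lin_scalel (T U : lmodType K) (v : U) (g : T -> K^o) :
  linear g -> linear (fun x => (g x : K) *: v).
Proof. by move=> lg c x y; rewrite lg scalerDl scalerA. Qed.

Lemma lin_scaler (T U : lmodType K) c (g : T -> U) :
  linear g -> linear (fun x => c *: g x).
Proof. by move=> lg d x y; rewrite lg scalerDr !scalerA mulrC. Qed.

Lemma lin_sum (T U : lmodType K) (I : Type) (r : seq I) (P : pred I)
    (g : I -> T -> U) :
  (forall i, linear (g i)) -> linear (fun x => \sum_(i <- r | P i) g i x).
Proof.
move=> lg c x y; rewrite scaler_sumr -big_split /=.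
by apply: eq_bigr => i _; rewrite lg.
Qed.

Lemma lin_pure1 (T : lmodType K) (U V : vectType K) (v : V) (g : T -> U) :
  linear g -> linear (fun x => pure (g x) v).
Proof.
move=> lg c x y; apply/matrixP => i j; rewrite !mxE lg linearP /=.
by rewrite mulrDl mulrA.
Qed.

Lemma lin_pure2 (T : lmodType K) (U V : vectType K) (u : U) (g : T -> V) :
  linear g -> linear (fun x => pure u (g x)).
Proof.
move=> lg c x y; apply/matrixP => i j; rewrite !mxE lg linearP /=.
by rewrite mulrDr mulrCA.
Qed.

Lemma lin_tlift1 (T : lmodType K) (U V W : vectType K) (f : U -> V -> W)
    (g : T -> tensor U V) :
  linear g -> linear (fun x => tlift f (g x)).
Proof. by move=> lg c x y; rewrite lg linearP. Qed.

Lemma lin_tlift2 (T : lmodType K) (U V W : vectType K)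
    (f : T -> U -> V -> W) (t : tensor U V) :
  (forall u v, linear (fun x => f x u v)) -> linear (fun x => tlift (f x) t).
Proof.
move=> lf c x y; rewrite !tliftE; move: c x y.
apply: lin_sum => i; apply: lin_sum => j; apply: lin_scaler; exact: lf.
Qed.

Lemma eq_tlift (U V W : vectType K) (f g : U -> V -> W) (t : tensor U V) :
  (forall u v, f u v = g u v) -> tlift f t = tlift g t.
Proof.
by move=> fg; rewrite !tliftE; do 2![apply: eq_bigr => ? _]; rewrite fg.
Qed.

Lemma tlift_comp (U V W X : vectType K) (F : W -> X) (f : U -> V -> W) t :
  linear F -> F (tlift f t) = tlift (fun u v => F (f u v)) t.
Proof.
move=> lF; pose FL := GRing.isLinear.Build K _ _ _ F lF.
pose Fl : {linear W -> X} := HB.pack F FL.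
rewrite !tliftE -[F _]/(Fl _) linear_sum; apply: eq_bigr => i _.
by rewrite linear_sum; apply: eq_bigr => j _; rewrite linearZ_LR.
Qed.

Lemma tlift_exchange (U V U' V' W : vectType K) (f : U -> V -> U' -> V' -> W)
    (s : tensor U V) (t : tensor U' V') :
  tlift (fun a b => tlift (f a b) t) s =
  tlift (fun c d => tlift (fun a b => f a b c d) s) t.
Proof.
have tE (X Y : vectType K) (g : X -> Y -> W) (x : tensor X Y) :
    tlift g x = \sum_p x p.1 p.2 *: g (vbasis {:X})`_p.1 (vbasis {:Y})`_p.2.
  by rewrite tliftE pair_big.
rewrite !tE; under eq_bigr => p _ do rewrite tE scaler_sumr.
rewrite exchange_big /=; apply: eq_bigr => q _; rewrite tE scaler_sumr.
by apply: eq_bigr => p _; rewrite !scalerA mulrC.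
Qed.
End Lin.

Lemma lin_comp (K : fieldType) (T U V : lmodType K) (f : U -> V) (g : T -> U) :
  linear f -> linear g -> linear (fun x => f (g x)).
Proof. by move=> lf lg a x y; rewrite lg lf. Qed.

Lemma linZ (K : fieldType) (U V : lmodType K) (f : U -> V) c x :
  linear f -> f (c *: x) = c *: f x.
Proof.
move=> lf; have f0 : f 0 = 0.
  by have := lf (-1) 0 0; rewrite scaler0 addr0 scaleN1r addNr.
by rewrite -[c *: x]addr0 lf f0 addr0.
Qed.

Definition bilin (K : fieldType) (U V W : lmodType K) (f : U -> V -> W) :=
  ((forall v, linear (f^~ v)) * (forall u, linear (f u)))%type.

Definition trilin (K : fieldType) (T U V W : lmodType K) (f : T -> U -> V -> W) :=
  ((forall u v, linear (fun t => f t u v)) *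
   (forall t v, linear (fun u => f t u v)) *
   (forall t u, linear (fun v => f t u v)))%type.

Section Sweedler.
Variables (K : fieldType) (H : falgType K) (Hs : hopf_algebra H).

(** Sweedler notation with binders: the arguments of [f] stand for h_1 and h_2. *)
Definition sweedler (W : vectType K) (h : H) (f : H -> H -> W) : W :=
  tlift f (comul Hs h).

Local Notation sw := sweedler.

Lemma lin_sw1 (T : lmodType K) (W : vectType K) (f : H -> H -> W) (g : T -> H) :
  linear g -> linear (fun x => sw (g x) f).
Proof. by move=> lg c x y; rewrite /sweedler lg !linearP. Qed.

Lemma lin_sw2 (T : lmodType K) (W : vectType K) (f : T -> H -> H -> W) h :
  (forall a b, linear (fun x => f x a b)) -> linear (fun x => sw h (f x)).
Proof. exact: lin_tlift2. Qed.

Lemma eq_sw (W : vectType K) (f g : H -> H -> W) h :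
  (forall a b, f a b = g a b) -> sw h f = sw h g.
Proof. exact: eq_tlift. Qed.

Lemma sw_comp (W X : vectType K) (F : W -> X) (f : H -> H -> W) h :
  linear F -> F (sw h f) = sw h (fun a b => F (f a b)).
Proof. exact: tlift_comp. Qed.

Lemma sw_exchange (W : vectType K) (f : H -> H -> H -> H -> W) h k :
  sw h (fun a b => sw k (f a b)) = sw k (fun c d => sw h (fun a b => f a b c d)).
Proof. exact: tlift_exchange. Qed.

End Sweedler.

(** The Sweedler rules ask for (multi)linear summands; these goals follow the syntax of the
    summand. *)
Ltac lin_tac := repeat first
  [ match goal with |- forall _, _ => move=> ? /= end
  | assumption
  | apply: lin_id
  | match goal with
    | Hl : linear ?f |- linear (fun x => ?f _) => apply: (lin_comp Hl)
    | Hl : bilin ?f |- linear (?f ?u) => exact: (Hl.2 u)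
    | Hl : bilin ?f |- linear (fun x => ?f _ ?v) => apply: (lin_comp (Hl.1 v))
    | Hl : bilin ?f |- linear (fun x => ?f ?u _) => apply: (lin_comp (Hl.2 u))
    | Hl : trilin ?f |- linear (fun x => ?f _ ?u ?v) => apply: (lin_comp (Hl.1.1 u v))
    | Hl : trilin ?f |- linear (fun x => ?f ?u _ ?v) => apply: (lin_comp (Hl.1.2 u v))
    | Hl : trilin ?f |- linear (fun x => ?f ?u ?v _) => apply: (lin_comp (Hl.2 u v))
    end
  | apply: lin_mulr | apply: lin_mull
  | apply: lin_scalel | apply: lin_scaler
  | apply: lin_sw1 | apply: lin_sw2
  | apply: lin_lfun | apply: lin_app
  | apply: lin_pure1 | apply: lin_pure2
  | apply: lin_tlift1 | apply: lin_tlift2 ].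

Section Rules.
Variables (K : fieldType) (H : falgType K) (Hs : hopf_algebra H).
Local Notation S := (antipode Hs).
Local Notation eps := (counit Hs).
Local Notation sw := (sweedler Hs).

Lemma sw_counitl (W : vectType K) (f : H -> W) h : linear f ->
  sw h (fun a b => (eps a : K) *: f b) = f h.
Proof.
move=> lf; rewrite -[in RHS](counitl Hs h) -/(sw h _) (sw_comp _ _ _ lf).
by apply: eq_sw => a b; rewrite linZ.
Qed.

Lemma sw_counitr (W : vectType K) (f : H -> W) h : linear f ->
  sw h (fun a b => (eps b : K) *: f a) = f h.
Proof.
move=> lf; rewrite -[in RHS](counitr Hs h) -/(sw h _) (sw_comp _ _ _ lf).
by apply: eq_sw => a b; rewrite linZ.
Qed.

Lemma sw_antl (W : vectType K) (f : H -> W) h : linear f ->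
  sw h (fun a b => f (S a * b)) = (eps h : K) *: f 1.
Proof.
by move=> lf; rewrite -(sw_comp _ _ _ lf) /sweedler antipodel linZ.
Qed.

Lemma sw_antr (W : vectType K) (f : H -> W) h : linear f ->
  sw h (fun a b => f (a * S b)) = (eps h : K) *: f 1.
Proof.
by move=> lf; rewrite -(sw_comp _ _ _ lf) /sweedler antipoder linZ.
Qed.

Lemma tlift_pureE (U V W : vectType K) (f : U -> V -> W) u v :
  bilin f -> tlift f (pure u v) = f u v.
Proof. by case=> l1 l2; apply: tlift_pure. Qed.

Lemma sw_mul (W : vectType K) (f : H -> H -> W) a b : bilin f ->
  sw (a * b) f = sw a (fun a1 a2 => sw b (fun b1 b2 => f (a1 * b1) (a2 * b2))).
Proof.
move=> lf; rewrite /sweedler comulM /tmul tlift_comp; last by lin_tac.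
apply: eq_tlift => a1 a2; rewrite tlift_comp; last by lin_tac.
by apply: eq_tlift => b1 b2; rewrite tlift_pureE.
Qed.

Lemma sw_one (W : vectType K) (f : H -> H -> W) : bilin f -> sw 1 f = f 1 1.
Proof. by move=> lf; rewrite /sweedler comul1 tlift_pureE. Qed.

Lemma sw_coassoc (W : vectType K) (f : H -> H -> H -> W) h : trilin f ->
  sw h (fun a b => sw a (fun x y => f x y b)) =
  sw h (fun a b => sw b (fun y z => f a y z)).
Proof.
move=> lf.
pose G := tlift (fun a t => tlift (fun b c => f a b c) t) :
  'Hom(tensor H (tensor H H), W).
have := congr1 G (comulA Hs h).
rewrite /tmap (tlift_comp (F := tassoc H H H)); last by lin_tac.
rewrite (tlift_comp (F := G)); last by lin_tac.
rewrite (tlift_comp (F := G)); last by lin_tac.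
move=> E; transitivity (tlift (fun a b => G (tassoc H H H (pure (comul Hs a) b))) (comul Hs h)).
  apply: eq_tlift => a b; rewrite /tassoc tlift_pureE; last by split=> ?; lin_tac.
  rewrite (tlift_comp (F := G)); last by lin_tac.
  apply: eq_tlift => x y; rewrite /G tlift_pureE; last by split=> ?; lin_tac.
  by rewrite tlift_pureE //; split=> ?; lin_tac.
rewrite E; apply: eq_tlift => a b; rewrite /G tlift_pureE //.
by split=> ?; lin_tac.
Qed.

End Rules.

Ltac blin := split=> ?; lin_tac.
Ltac tlin := split; [split|]=> ? ?; lin_tac.

(** * The antipode reverses products and coproducts *)

Section Antipode.
Variables (K : fieldType) (H : falgType K) (Hs : hopf_algebra H).
Local Notation S := (antipode Hs).
Local Notation eps := (counit Hs).
Local Notation sw := (sweedler Hs).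

Lemma antipode1 : S 1 = 1.
Proof.
have := antipodel Hs 1; rewrite -/(sw 1 _) sw_one; last by blin.
by rewrite mulr1 counit1 scale1r.
Qed.

Lemma counit_antipode h : eps (S h) = eps h.
Proof.
rewrite -[LHS](sw_counitr Hs (f := fun a => eps (S a))); last by lin_tac.
under eq_sw => a b do rewrite [_ *: _]mulrC -counitM.
rewrite (sw_antl Hs (f := eps)); last by lin_tac.
by rewrite counit1 [_ *: _]mulr1.
Qed.

(** Both sides are convolution inverses of the multiplication on H (x) H; [X] is the triple product
    S(a_1 b_1) (a_2 b_2) S(b_3) S(a_3), contracted from either end. *)
Lemma antipodeM a b : S (a * b) = S b * S a.
Proof.
pose X := sw a (fun a1 a' => sw a' (fun a2 a3 =>
   sw b (fun b1 b' => sw b' (fun b2 b3 =>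
   S (a1 * b1) * (a2 * (b2 * S b3) * S a3))))).
transitivity X.
  apply/esym; rewrite /X.
  under eq_sw => a1 a'.
    under eq_sw => a2 a3.
      under eq_sw => b1 b'.
        rewrite (sw_antr _ (f := fun z => S (a1 * b1) * (a2 * z * S a3))); last by lin_tac.
        over.
      rewrite (sw_counitr _ (f := fun z => S (a1 * z) * (a2 * 1 * S a3))); last by lin_tac.
      rewrite mulr1; over.
    rewrite (sw_antr _ (f := fun z => S (a1 * b) * z)); last by lin_tac.
    rewrite mulr1; over.
  by rewrite (sw_counitr _ (f := fun z => S (z * b))) //; lin_tac.
rewrite /X -(sw_coassoc _ (f := fun a1 a2 a3 =>
   sw b (fun b1 b' => sw b' (fun b2 b3 =>
   S (a1 * b1) * (a2 * (b2 * S b3) * S a3))))); last by tlin.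
under eq_sw => a' a3.
  under eq_sw => a1 a2.
    rewrite -(sw_coassoc _ (f := fun b1 b2 b3 =>
       S (a1 * b1) * (a2 * (b2 * S b3) * S a3))); last by tlin.
    over.
  rewrite sw_exchange.
  under eq_sw => b' b3.
    have -> : sw a' (fun a1 a2 => sw b' (fun b1 b2 =>
        S (a1 * b1) * (a2 * (b2 * S b3) * S a3))) =
        sw (a' * b') (fun x y => S x * y * (S b3 * S a3)).
      rewrite sw_mul; last by blin.
      by apply: eq_sw => a1 a2; apply: eq_sw => b1 b2; rewrite !mulrA.
    rewrite (sw_antl _ (f := fun z => z * (S b3 * S a3))); last by lin_tac.
    rewrite mul1r counitM [_ * _]mulrC -scalerA.
    over.
  rewrite (sw_counitl _ (f := fun z => (eps a' : K) *: (S z * S a3))); last by lin_tac.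
  over.
by rewrite (sw_counitl _ (f := fun z => S b * S z)) //; lin_tac.
Qed.

(** The same argument for the two candidate convolution inverses of the comultiplication, with [Z]
    as the triple product. *)
Lemma sw_antipode (W : vectType K) (f : H -> H -> W) h : bilin f ->
  sw (S h) f = sw h (fun a b => f (S b) (S a)).
Proof.
move=> lf.
pose Z := sw h (fun p q => sw (S p) (fun x y => sw q (fun c d =>
  sw c (fun c1 c2 => sw d (fun d1 d2 => f (x * c1 * S d2) (y * c2 * S d1)))))).
transitivity Z.
  apply/esym; rewrite /Z.
  under eq_sw => p q.
    under eq_sw => x y.
      rewrite (sw_coassoc _ (f := fun c1 c2 d =>
        sw d (fun d1 d2 => f (x * c1 * S d2) (y * c2 * S d1)))); last by tlin.
      under eq_sw => c1 r.
        rewrite -(sw_coassoc _ (f := fun c2 d1 d2 =>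
           f (x * c1 * S d2) (y * c2 * S d1))); last by tlin.
        under eq_sw => m d2.
          under eq_sw => c2 d1 do rewrite -[y * _ * _]mulrA.
          rewrite (sw_antr _ (f := fun z => f (x * c1 * S d2) (y * z))); last by lin_tac.
          rewrite mulr1; over.
        rewrite (sw_counitl _ (f := fun z => f (x * c1 * S z) y)); last by lin_tac.
        rewrite -mulrA; over.
      rewrite (sw_antr _ (f := fun z => f (x * z) y)); last by lin_tac.
      rewrite mulr1; over.
    rewrite -(@sw_comp _ _ _ _ _ (fun w => (eps q : K) *: w)); last by lin_tac.
    over.
  by rewrite (sw_counitr _ (f := fun z => sw (S z) f)) //; lin_tac.
rewrite /Z.
under eq_sw => p q do rewrite sw_exchange.
rewrite -(sw_coassoc _ (f := fun p c d => sw (S p) (fun x y =>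
  sw c (fun c1 c2 => sw d (fun d1 d2 => f (x * c1 * S d2) (y * c2 * S d1)))))); last by tlin.
under eq_sw => k d.
  under eq_sw => p c.
    rewrite -(sw_mul _ (f := fun x y =>
      sw d (fun d1 d2 => f (x * S d2) (y * S d1)))); last by blin.
    over.
  rewrite (sw_antl _ (f := fun z => sw z (fun x y =>
      sw d (fun d1 d2 => f (x * S d2) (y * S d1))))); last by lin_tac.
  rewrite sw_one; last by blin.
  over.
rewrite (sw_counitl _ (f := fun z => sw z (fun d1 d2 => f (1 * S d2) (1 * S d1)))); last by lin_tac.
by apply: eq_sw => a b; rewrite !mul1r.
Qed.

End Antipode.

Lemma trace_tlift (K : fieldType) (U V W : vectType K) (f : 'End(W))
    (phi : U -> V -> W -> K^o) (v : U -> V -> W) (t : tensor U V) :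
    (forall a b, linear (phi a b)) ->
    (forall x, f x = tlift (fun a b => (phi a b x : K) *: v a b) t) ->
  trace f = tlift (fun a b => phi a b (v a b)) t.
Proof.
move=> lphi fE; rewrite tliftE pair_big /=.
pose psi (p : 'I_(\dim {:U}) * 'I_(\dim {:V})) x : K^o :=
  t p.1 p.2 *: phi (vbasis {:U})`_p.1 (vbasis {:V})`_p.2 x.
rewrite (trace_rank_one (phi := psi)
  (v := fun p => v (vbasis {:U})`_p.1 (vbasis {:V})`_p.2)) //.
  by move=> p; apply: lin_scaler.
move=> x; rewrite fE tliftE pair_big /=.
by apply: eq_bigr => p _; rewrite scalerA.
Qed.

(** * The regular character *)

Section RegularTrace.
Variables (K : fieldType) (H : falgType K).

Lemma amullE (a x : H) : amull a x = a * x.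
Proof. by rewrite lfunE. Qed.

Lemma amulrE (a x : H) : amulr a x = x * a.
Proof. by rewrite lfunE. Qed.

Definition regtr : 'Hom(H, K^o) := linfun (fun h : H => trace (amull h) : K^o).

Lemma regtrE h : regtr h = trace (amull h).
Proof.
have l : linear (fun h : H => trace (amull h) : K^o).
  move=> a x y; apply: etrans (trace_is_linear a (amull x) (amull y)).
  apply: (congr1 (@trace K H)); apply/lfunP => z.
  by rewrite add_lfunE scale_lfunE !amullE mulrDl scalerAl.
pose FL := GRing.isLinear.Build K _ _ _ (fun h : H => trace (amull h) : K^o) l.
pose F : {linear H -> K^o} := HB.pack (fun h : H => trace (amull h) : K^o) FL.
exact: (lfunE F h).
Qed.

Lemma regtrC a b : regtr (a * b) = regtr (b * a).
Proof.
have E x y : amull (x * y : H) = (amull x \o amull y)%VF.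
  by apply/lfunP => z; rewrite comp_lfunE !amullE mulrA.
by rewrite !regtrE !E trace_compC.
Qed.

Lemma regtr1 : regtr 1 = (\dim {:H})%:R.
Proof.
rewrite regtrE trace_idempotent => [|x]; last by rewrite !amullE !mul1r.
congr _%:R; congr (\dim _); apply/eqP; rewrite eqEsubv subvf.
by apply/subvP => x _; rewrite -[x]mul1r -amullE memv_img ?memvf.
Qed.

Hypothesis regtr_nondeg : forall x, (forall y, regtr (x * y) = 0) -> x = 0.

Local Notation e := (vbasis {:H}).

(** Nondegeneracy makes the Gram matrix of the trace form invertible, and its inverse gives the dual
    basis. *)
Lemma regtr_dual_basis : exists y : 'I_(\dim {:H}) -> H,
  forall x, x = \sum_(i < \dim {:H}) (regtr (y i * x) : K) *: e`_i /\
            x = \sum_(i < \dim {:H}) (regtr (x * e`_i) : K) *: y i.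
Proof.
have eb : basis_of {:H} e := vbasisP fullv.
have regtr_sum (I : finType) (F : I -> H) (c : I -> K) z :
    regtr ((\sum_i c i *: F i) * z) = \sum_i c i * regtr (F i * z).
  rewrite mulr_suml linear_sum; apply: eq_bigr => k _.
  by rewrite -scalerAl linearZ.
pose G : 'M[K]_(\dim {:H}) := \matrix_(i, j) regtr (e`_i * e`_j).
have Gfree : row_free G.
  rewrite -kermx_eq0; apply/eqP/row_matrixP => i; rewrite row0.
  have : row i (kermx G) *m G = 0 by rewrite -row_mul mulmx_ker row0.
  move: (row i _) => w wG.
  pose x := \sum_j w 0 j *: e`_j.
  have x0 : x = 0.
    apply: regtr_nondeg => y.
    rewrite [y](coord_vbasis (memvf y)) mulr_sumr linear_sum big1 // => j _.
    rewrite -scalerAr linearZ /= regtr_sum.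
    have /rowP/(_ j) := wG; rewrite !mxE => E.
    rewrite -[RHS](scaler0 _ (coord e j y)); congr (_ *: _).
    by apply: etrans E; apply: eq_bigr => k _; rewrite mxE.
  apply/rowP => j; rewrite [RHS]mxE.
  by rewrite -(coord_sum_free (w 0) j (basis_free eb)) -/x x0 linear0.
have Gu : G \in unitmx by rewrite -row_free_unit.
pose y i := \sum_j invmx G i j *: e`_j.
have dual (i j : 'I_(\dim {:H})) : regtr (y i * e`_j) = (i == j)%:R.
  transitivity ((invmx G *m G) i j); last by rewrite mulVmx // mxE.
  rewrite mxE mulr_suml linear_sum; apply: eq_bigr => k _.
  by rewrite mxE -scalerAl linearZ.
exists y => x; split.
  rewrite [LHS](coord_vbasis (memvf x)); apply: eq_bigr => i _; congr (_ *: _).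
  rewrite [in RHS](coord_vbasis (memvf x)) mulr_sumr linear_sum (bigD1 i) //=.
  rewrite -scalerAr linearZ /= dual eqxx big1 ?addr0 => [|j ji].
    by rewrite [RHS]mulr1.
  by rewrite -scalerAr linearZ /= dual eq_sym (negPf ji) [LHS]mulr0.
apply/eqP; rewrite -subr_eq0; apply/eqP/regtr_nondeg => z.
rewrite [z](coord_vbasis (memvf z)) mulr_sumr linear_sum big1 // => j _.
rewrite -scalerAr linearZ mulrBl linearB /= regtr_sum (bigD1 j) //=.
rewrite dual eqxx mulr1 big1 ?addr0 ?subrr ?scaler0 // => i ij.
by rewrite dual (negPf ij) mulr0.
Qed.

(** Expanded in dual bases, both traces become the sum of the chi(y_i a e_i). *)
Lemma trace_amulr a : trace (amulr a) = regtr a.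
Proof.
have [y yP] := regtr_dual_basis.
have l1 i : linear (fun x => regtr (y i * x)) by lin_tac.
have l2 i : linear (fun x => regtr (x * e`_i)) by lin_tac.
rewrite regtrE (trace_rank_one (f := amull a) l1 (v := fun i : 'I__ => a * e`_i)) => [|x].
  rewrite (trace_rank_one l2 (v := fun i : 'I__ => y i * a)) => [|x].
    by apply: eq_bigr => i _; rewrite mulrA.
  rewrite amulrE {1}[x](yP x).2 mulr_suml.
  by apply: eq_bigr => i _; rewrite scalerAl.
rewrite amullE {1}[x](yP x).1 mulr_sumr.
by apply: eq_bigr => i _; rewrite scalerAr.
Qed.

End RegularTrace.

Lemma linfunE (K : fieldType) (U V : vectType K) (f : U -> V) x :
  linear f -> linfun f x = f x.
Proof.
move=> lf; pose FL := GRing.isLinear.Build K _ _ _ f lf.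
pose F : {linear U -> V} := HB.pack f FL.
exact: (lfunE F x).
Qed.

(** * Integrals *)

Section Integral.
Variables (K : fieldType) (charK : [pchar K] =i pred0).
Variables (H : falgType K) (Hs : hopf_algebra H) (ssH : semisimple H).
Variables (L : H) (LP : normalized_integral Hs L).
Local Notation S := (antipode Hs).
Local Notation eps := (counit Hs).
Local Notation sw := (sweedler Hs).
Local Notation chi := (regtr H).

Lemma int_l h : h * L = (eps h : K) *: L. Proof. by case: (LP.1 h). Qed.
Lemma int_r h : L * h = (eps h : K) *: L. Proof. by case: (LP.1 h). Qed.
Lemma int1 : eps L = 1. Proof. by case: LP. Qed.

(** Write h as eps(h_1) h_2, absorb the counit by L h_1 = eps(h_1) L, and cancel h_2 S(h_3). The
    next two lemmas use the same device with h L. *)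
Lemma sw_int_r (W : vectType K) (f : H -> H -> W) h : bilin f ->
  sw L (fun a b => f (a * h) b) = sw L (fun a b => f a (b * S h)).
Proof.
move=> lf; apply/esym.
rewrite -(@sw_counitl _ _ Hs _ (fun z => sw L (fun a b => f a (b * S z)))); last by lin_tac.
under eq_sw => p q.
  rewrite -(@linZ _ _ _ (fun z => sw z (fun a b => f a (b * S q)))); last by lin_tac.
  rewrite -int_r sw_mul; last by blin.
  rewrite sw_exchange; over.
rewrite (sw_coassoc _ (f := fun p1 p2 q => sw L (fun a b => f (a * p1) (b * p2 * S q)))); last by tlin.
under eq_sw => p1 r.
  rewrite sw_exchange.
  under eq_sw => a b.
    under eq_sw => p2 q do rewrite -mulrA.
    rewrite (sw_antr _ (f := fun z => f (a * p1) (b * z))); last by lin_tac.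
    rewrite mulr1; over.
  rewrite -(@sw_comp _ _ _ _ _ (fun w => (eps r : K) *: w)); last by lin_tac.
  over.
by rewrite (sw_counitr _ (f := fun z => sw L (fun a b => f (a * z) b))) //; lin_tac.
Qed.

Lemma sw_int_l (W : vectType K) (f : H -> H -> W) h : bilin f ->
  sw L (fun a b => f a (h * b)) = sw L (fun a b => f (S h * a) b).
Proof.
move=> lf; apply/esym.
rewrite -(@sw_counitr _ _ Hs _ (fun z => sw L (fun a b => f (S z * a) b))); last by lin_tac.
under eq_sw => p q.
  rewrite -(@linZ _ _ _ (fun z => sw z (fun a b => f (S p * a) b))); last by lin_tac.
  rewrite -int_l sw_mul; last by blin.
  over.
rewrite -(sw_coassoc _ (f := fun p q1 q2 => sw L (fun a b => f (S p * (q1 * a)) (q2 * b)))); last by tlin.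
under eq_sw => r q2.
  rewrite sw_exchange.
  under eq_sw => a b.
    under eq_sw => p q1 do rewrite mulrA.
    rewrite (sw_antl _ (f := fun z => f (z * a) (q2 * b))); last by lin_tac.
    rewrite mul1r; over.
  rewrite -(@sw_comp _ _ _ _ _ (fun w => (eps r : K) *: w)); last by lin_tac.
  over.
by rewrite (sw_counitl _ (f := fun z => sw L (fun a b => f a (z * b)))) //; lin_tac.
Qed.

Lemma sw_int_casimir (W : vectType K) (f : H -> H -> W) h : bilin f ->
  sw L (fun a b => f (h * a) (S b)) = sw L (fun a b => f a (S b * h)).
Proof.
move=> lf; apply/esym.
rewrite -(@sw_counitl _ _ Hs _ (fun z => sw L (fun a b => f a (S b * z)))); last by lin_tac.
under eq_sw => p q.
  rewrite -(@linZ _ _ _ (fun z => sw z (fun a b => f a (S b * q)))); last by lin_tac.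
  rewrite -int_l sw_mul; last by blin.
  over.
rewrite (sw_coassoc _ (f := fun p1 p2 q => sw L (fun a b => f (p1 * a) (S (p2 * b) * q)))); last by tlin.
under eq_sw => p1 r.
  rewrite sw_exchange.
  under eq_sw => a b.
    under eq_sw => p2 q do rewrite antipodeM -mulrA.
    rewrite (sw_antl _ (f := fun z => f (p1 * a) (S b * z))); last by lin_tac.
    rewrite mulr1; over.
  rewrite -(@sw_comp _ _ _ _ _ (fun w => (eps r : K) *: w)); last by lin_tac.
  over.
by rewrite (sw_counitr _ (f := fun z => sw L (fun a b => f (z * a) (S b)))) //; lin_tac.
Qed.

Lemma average_central c h :
  h * sw L (fun a b => a * c * S b) = sw L (fun a b => a * c * S b) * h.
Proof.
rewrite (@sw_comp _ _ _ _ _ (fun z => h * z)); last by lin_tac.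
rewrite (@sw_comp _ _ _ _ _ (fun z => z * h)); last by lin_tac.
under eq_sw => a b do rewrite !mulrA.
under [RHS]eq_sw => a b do rewrite -mulrA.
by rewrite -(sw_int_casimir _ (f := fun a b => a * c * b)) //; blin.
Qed.

(** The component of 1 in [I] along a complement is a right identity of [I]; averaging over the
    Casimir element L_1 (x) S(L_2) keeps this property and makes it central. *)
Lemma ideal_idempotent (I : {vspace H}) :
    (forall a x, x \in I -> a * x \in I) -> (forall a x, x \in I -> x * a \in I) ->
  exists f, [/\ f \in I, forall h, h * f = f * h & forall x, x \in I -> x * f = x].
Proof.
move=> Il Ir; have [J [Jl IJ IJ0]] := ssH Il.
have /memv_addP[f0 f0I [j jJ E]] : 1 \in (I + J)%VS by rewrite IJ memvf.
have xf0 x : x \in I -> x * f0 = x.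
  move=> xI; rewrite -[RHS]mulr1 E mulrDr.
  have : x * j \in (I :&: J)%VS by rewrite memv_cap Ir //= Jl.
  by rewrite IJ0 memv0 => /eqP->; rewrite addr0.
exists (sw L (fun a b => a * f0 * S b)); split.
- rewrite /sweedler tliftE; apply: memv_suml => i _; apply: memv_suml => k _.
  by apply: memvZ; apply: Ir; apply: Il.
- exact: average_central.
move=> x xI; rewrite (@sw_comp _ _ _ _ _ (fun z => x * z)); last by lin_tac.
under eq_sw => a b do rewrite !mulrA xf0 ?Ir // -mulrA.
rewrite (sw_antr _ (f := fun z => x * z)); last by lin_tac.
by rewrite mulr1 int1 scale1r.
Qed.

(** This stands in for the Wedderburn decomposition: the regular trace of the central idempotent of
    an ideal is the dimension of the ideal. *)
Lemma ideal_regtr0 (I : {vspace H}) :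
    (forall a x, x \in I -> a * x \in I) -> (forall a x, x \in I -> x * a \in I) ->
    (forall f, f \in I -> (forall h, h * f = f * h) -> chi f = 0) ->
  forall x, x \in I -> x = 0.
Proof.
move=> Il Ir I0 x xI; have [f [fI fC xf]] := ideal_idempotent Il Ir.
have f0 : amull f = 0.
  apply: (idempotent_trace0 charK) => [y|]; first by rewrite !amullE mulrA xf.
  by rewrite -regtrE I0.
by rewrite -(xf x xI) -[f]mulr1 -[f * 1]amullE f0 zero_lfunE mulr0.
Qed.

Lemma regtr_nondeg x : (forall y, chi (x * y) = 0) -> x = 0.
Proof.
move=> x0; pose F := linfun (fun x => (chi \o amull x)%VF).
have FE z y : F z y = chi (z * y).
  rewrite linfunE ?comp_lfunE ?amullE // => a v w.
  by apply/lfunP => t; rewrite add_lfunE scale_lfunE !comp_lfunE !amullE mulrDl -scalerAl linearP.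
have FP z : reflect (forall y, chi (z * y) = 0) (z \in lker F).
  rewrite memv_ker; apply: (iffP eqP) => [E y|E]; first by rewrite -FE E zero_lfunE.
  by apply/lfunP => y; rewrite FE E zero_lfunE.
apply: (@ideal_regtr0 (lker F)); last exact/FP.
- move=> a y /FP yP; apply/FP => z.
  by rewrite regtrC mulrA regtrC yP.
- by move=> a y /FP yP; apply/FP => z; rewrite -mulrA yP.
by move=> f /FP/(_ 1); rewrite mulr1.
Qed.

(* For H acting on a simple module V, this is the isomorphism V -> V^** whose
   trace is dim V. *)
Definition drinfeld_elt := sw L (fun a b => S b * a).
Local Notation u := drinfeld_elt.

Lemma drinfeld_eltM h : u * h = S (S h) * u.
Proof.
rewrite /drinfeld_elt (@sw_comp _ _ _ _ _ (fun z => z * h)); last by lin_tac.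
rewrite (@sw_comp _ _ _ _ _ (fun z => S (S h) * z)); last by lin_tac.
under eq_sw => a b do rewrite -mulrA.
rewrite (sw_int_r _ (f := fun a b => S b * a)); last by blin.
by apply: eq_sw => a b; rewrite antipodeM mulrA.
Qed.

(** Under the trace, S(L_2) L_1 may be turned into L_1 S(L_2) = 1, since c is central. *)
Lemma regtr_drinfeld_elt c : (forall h, h * c = c * h) -> chi (u * c) = chi c.
Proof.
move=> cC; rewrite /drinfeld_elt (@sw_comp _ _ _ _ _ (fun z => chi (z * c))); last by lin_tac.
under eq_sw => a b do rewrite -mulrA regtrC [a * c]cC -mulrA.
rewrite (sw_antr _ (f := fun z => chi (c * z))); last by lin_tac.
by rewrite int1 mulr1 scale1r.
Qed.

(** Since u a = S^2(a) u, the right annihilator of u is a two-sided ideal; on its central elements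
    chi(f) = chi(u f) = 0. *)
Lemma drinfeld_elt_lreg x : u * x = 0 -> x = 0.
Proof.
move=> ux; apply: (@ideal_regtr0 (lker (amull u))); last by rewrite memv_ker amullE ux.
- move=> a y; rewrite !memv_ker !amullE => /eqP uy.
  by rewrite mulrA drinfeld_eltM -mulrA uy mulr0.
- by move=> a y; rewrite !memv_ker !amullE => /eqP uy; rewrite mulrA uy mul0r.
move=> f; rewrite memv_ker amullE => /eqP uf fC.
by rewrite -regtr_drinfeld_elt // uf linear0.
Qed.

End Integral.

(** * The Frobenius form [lam] and its dual bases *)

Section Integral2.
Variables (K : fieldType) (charK : [pchar K] =i pred0).
Variables (H : falgType K) (Hs : hopf_algebra H) (ssH : semisimple H).
Variables (L : H) (LP : normalized_integral Hs L).
Local Notation S := (antipode Hs).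
Local Notation eps := (counit Hs).
Local Notation sw := (sweedler Hs).
Local Notation chi := (regtr H).
Local Notation u := (drinfeld_elt Hs L).
Let ndeg := regtr_nondeg charK ssH LP.
Let intr := int_r LP.
Let eps1 := int1 LP.

Lemma lker0_bij (V : vectType K) (f : 'End(V)) :
  (forall x, f x = 0 -> x = 0) -> exists2 g : 'End(V), cancel f g & cancel g f.
Proof.
move=> f0; have kf : lker f == 0%VS.
  rewrite -subv0; apply/subvP => x; rewrite memv_ker memv0 => /eqP/f0->.
  by rewrite eqxx.
by exists (f^-1)%VF; [exact: lker0_lfunK | exact: lker0_lfunVK].
Qed.

Lemma drinfeld_elt_unit : u \is a GRing.unit.
Proof.
have inj x : amull u x = 0 -> x = 0.
  by rewrite amullE => /(drinfeld_elt_lreg charK ssH LP).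
have [g gK Kg] := lker0_bij inj.
have uv : u * g 1 = 1 by rewrite -amullE Kg.
apply/unitrP; exists (g 1); split=> //; apply/eqP; rewrite -subr_eq0; apply/eqP.
by apply: inj; rewrite amullE mulrBr mulrA uv mul1r mulr1 subrr.
Qed.

Lemma antipode_eq0 h : S h = 0 -> h = 0.
Proof.
move=> Sh; apply: (drinfeld_elt_lreg charK ssH LP).
by rewrite (drinfeld_eltM LP) Sh linear0 mul0r.
Qed.

Lemma antipode_bij : exists2 T : 'End(H), cancel S T & cancel T S.
Proof. exact: lker0_bij antipode_eq0. Qed.

Lemma antipode_inj : injective S.
Proof. by have [T ST _] := antipode_bij; apply: can_inj ST. Qed.

Lemma antipode_surj h : exists k, h = S k.
Proof. by have [T _ TS] := antipode_bij; exists (T h); rewrite TS. Qed.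

Lemma antipodeSS h : S (S h) = u * h * u^-1.
Proof. by rewrite (drinfeld_eltM LP) mulrK ?drinfeld_elt_unit. Qed.

(** Conjugation by S exchanges left and right multiplications. *)
Lemma regtr_antipode h : chi (S h) = chi h.
Proof.
have [T ST TS] := antipode_bij.
rewrite -(trace_amulr ndeg) regtrE.
have -> : amulr (S h) = ((S \o amull h) \o T)%VF.
  by apply/lfunP => x; rewrite !comp_lfunE amulrE amullE antipodeM TS.
rewrite trace_compC (_ : (T \o (S \o amull h))%VF = amull h) //.
by apply/lfunP => x; rewrite !comp_lfunE ST.
Qed.

Lemma antipode_int : S L = L.
Proof.
have left h : h * S L = (eps h : K) *: S L.
  have [k ->] := antipode_surj h.
  by rewrite -antipodeM intr linearZ /= counit_antipode.
have := left L; rewrite eps1 scale1r => <-.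
by rewrite intr counit_antipode eps1 scale1r.
Qed.

Lemma sw_int_antipode (W : vectType K) (f : H -> H -> W) : bilin f ->
  sw L f = sw L (fun a b => f (S b) (S a)).
Proof. by move=> lf; rewrite -{1}antipode_int sw_antipode. Qed.

(* Both sides are determined by the traces of the maps R_a R_c, where
   c = L_1 chi(S L_2). *)
Lemma int_regtr b : sw L (fun x y => (chi (S y * b) : K) *: x) = b * u.
Proof.
pose c := sw L (fun x y => (chi (S y) : K) *: x).
have cE x : sw L (fun p q => (chi (S q * x) : K) *: p) = x * c.
  rewrite /c (@sw_comp _ _ _ _ _ (fun z => x * z)); last by lin_tac.
  under [RHS]eq_sw => p q do rewrite -scalerAr.
  by rewrite (sw_int_casimir LP _ (f := fun p q => (chi q : K) *: p)) //; blin.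
suff <- : c = u by [].
apply/eqP; rewrite -subr_eq0; apply/eqP/ndeg => a.
rewrite mulrBl linearB /=; apply/eqP; rewrite subr_eq0; apply/eqP.
apply: etrans (esym (trace_amulr ndeg (c * a))) _.
rewrite (@trace_tlift _ _ _ _ _ (fun p q z => chi (S q * z)) (fun p q => p * a) (comul Hs L)).
- rewrite /drinfeld_elt (@sw_comp _ _ _ _ _ (fun z => chi (z * a))); last by lin_tac.
  rewrite -/(sw L _); under eq_sw => p q do rewrite mulrA.
  by [].
- by move=> p q; lin_tac.
move=> x; rewrite amulrE mulrA -cE (@sw_comp _ _ _ _ _ (fun z => z * a)); last by lin_tac.
by apply: eq_sw => p q; rewrite scalerAl.
Qed.

Definition cointegral : 'Hom(H, K^o) := (chi \o amulr (u^-1)%R)%VF.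
Local Notation lam := cointegral.

Lemma lamE b : lam b = chi (b * u^-1).
Proof. by rewrite comp_lfunE amulrE. Qed.

Lemma lamSS z : lam (S (S z)) = lam z.
Proof.
rewrite antipodeSS !lamE regtrC !mulrA mulVr ?drinfeld_elt_unit // mul1r.
by [].
Qed.

(** So L_1 and S(L_2) are dual bases for the form lam(x y). *)
Lemma int_lam b : sw L (fun x y => (lam (S y * b) : K) *: x) = b.
Proof.
under eq_sw => x y do rewrite lamE -mulrA.
by rewrite int_regtr mulrVK ?drinfeld_elt_unit.
Qed.

Lemma int_lam_l b : sw L (fun x y => (lam (x * b) : K) *: y) = S b.
Proof.
apply: antipode_inj; rewrite (@sw_comp _ _ _ _ _ S); last by lin_tac.
rewrite -[RHS]int_lam [RHS]sw_int_antipode; last by blin.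
by apply: eq_sw => x y; rewrite linearZ -!antipodeM lamSS.
Qed.

(** Expand x as L_1 lam(S(L_2) x): the sum becomes lam(L_1) L_2 lam(S(L_3) x), and lam(L_1) L_2 =
    1. *)
Lemma lam_int x : sw x (fun a b => (lam a : K) *: b) = (lam x : K) *: 1.
Proof.
pose G r := sw r (fun b q => (lam (S q * x) : K) *: b).
have lG : linear G by rewrite /G; lin_tac.
rewrite -{1}[x]int_lam (@sw_comp _ _ _ _ _ (fun z => sw z (fun a b => (lam a : K) *: b))); last by lin_tac.
under eq_sw => p q.
  rewrite (@linZ _ _ _ (fun z => sw z (fun a b => (lam a : K) *: b))); last by lin_tac.
  rewrite (@sw_comp _ _ _ _ _ (fun w => (lam (S q * x) : K) *: w)); last by lin_tac.
  over.
rewrite (sw_coassoc _ (f := fun a b q => (lam (S q * x) : K) *: ((lam a : K) *: b))); last by tlin.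
transitivity (G (sw L (fun a r => (lam (a * 1) : K) *: r))).
  rewrite (sw_comp _ _ _ lG); apply: eq_sw => a r.
  rewrite (linZ _ _ lG) mulr1 /G (@sw_comp _ _ _ _ _ (fun w => (lam a : K) *: w)); last by lin_tac.
  by apply: eq_sw => b q; rewrite !scalerA mulrC.
by rewrite int_lam_l antipode1 /G sw_one ?antipode1 ?mul1r //; blin.
Qed.

Lemma lamL : lam L = 1.
Proof.
have := congr1 eps (int_lam_l 1); rewrite antipode1 counit1 => <-.
rewrite (@sw_comp _ _ _ _ _ eps); last by lin_tac.
rewrite -[LHS](sw_counitr Hs (f := lam)); last by lin_tac.
by apply: eq_sw => a b; rewrite linearZ mulr1 [LHS]mulrC.
Qed.

(** Radford's trace formula, read off from the dual bases. *)
Lemma trace_lam (F : 'End(H)) : trace F = sw L (fun x y => lam (S y * F x)).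
Proof.
rewrite (@trace_tlift _ _ _ _ _ (fun p q z => lam (S q * z)) (fun p q => F p) (comul Hs L)) //.
  by move=> p q; lin_tac.
move=> x; rewrite -{1}[x]int_lam (@sw_comp _ _ _ _ _ F); last by lin_tac.
by apply: eq_sw => p q; rewrite linearZ.
Qed.

(** The convolution phi * S^2. Taking phi = eps gives S^2 itself, while phi = chi gives an operator
    with computable eigenvalues; [lam 1] links the two traces. *)
Definition convSS (phi : 'Hom(H, K^o)) : 'End(H) :=
  linfun (fun h => sw h (fun a b => (phi a : K) *: S (S b))).

Lemma convSSE phi h : convSS phi h = sw h (fun a b => (phi a : K) *: S (S b)).
Proof. by rewrite linfunE //; lin_tac. Qed.

Lemma trace_convSS phi : trace (convSS phi) = (phi L : K) * lam 1.
Proof.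
rewrite trace_lam.
under eq_sw => x y.
  rewrite convSSE (@sw_comp _ _ _ _ _ (fun w => lam (S y * w))); last by lin_tac.
  under eq_sw => a b do rewrite -scalerAr linearZ /= -antipodeM.
  over.
rewrite (sw_coassoc _ (f := fun a b y => (phi a : K) *: lam (S (S b * y)))); last by tlin.
under eq_sw => a r.
  rewrite (sw_antl _ (f := fun z => (phi a : K) *: lam (S z))); last by lin_tac.
  over.
rewrite (sw_counitr _ (f := fun a => (phi a : K) *: lam (S 1))) ?antipode1 //.
by lin_tac.
Qed.

End Integral2.

Lemma lin_sumE (K : fieldType) (U V : lmodType K) (f : U -> V) (I : Type)
    (r : seq I) (P : pred I) (F : I -> U) :
  linear f -> f (\sum_(i <- r | P i) F i) = \sum_(i <- r | P i) f (F i).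
Proof.
move=> lf; pose FL := GRing.isLinear.Build K _ _ _ f lf.
pose fl : {linear U -> V} := HB.pack f FL.
exact: (linear_sum fl).
Qed.

(** * Grouplike elements *)

Section GroupLike.
Variables (K : fieldType) (H : falgType K) (Hs : hopf_algebra H).
Local Notation eps := (counit Hs).
Local Notation sw := (sweedler Hs).

(** The coproduct condition is tested on all bilinear maps, so that it serves directly as a rule for
    [sw x f]. *)
Definition grouplike (x : H) :=
  eps x = 1 /\ forall (W : vectType K) (f : H -> H -> W), bilin f -> sw x f = f x x.

Lemma grouplikeX x k : grouplike x -> grouplike (x ^+ k).
Proof.
move=> [ex gx]; elim: k => [|k [ek gk]].
  by rewrite expr0; split=> [|W f lf]; [exact: counit1 | exact: sw_one].
rewrite exprS; split=> [|W f lf]; first by rewrite counitM ex ek mulr1.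
rewrite sw_mul // gx; last by blin.
by rewrite gk //; blin.
Qed.

Lemma grouplike_free (s : seq H) :
  uniq s -> (forall x, x \in s -> grouplike x) -> free s.
Proof.
elim: s => [|t s IHs] /=; first by rewrite nil_free.
move=> /andP[ts us] gs.
have fs : free s by apply: IHs => // x xs; apply: gs; rewrite inE xs orbT.
have [et gt] : grouplike t by apply: gs; rewrite mem_head.
rewrite free_cons fs andbT; apply/negP => tin.
pose X := in_tuple s; have fX : free X by [].
have tE := coord_span (tin : t \in <<X>>%VS).
have ct i : coord X i t = 0.
  apply/eqP/negPn/negP => c0; case/negP: ts.
  (* In t (x) t = sum of the c_j x_j (x) x_j, reading the i-th coordinate of the second factor gives
     c_i t = c_i x_i. *)
  pose F (a b : H) := coord X i b *: a.
  have lF : bilin F.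
    split=> v a x y; first by rewrite /F scalerDr !scalerA mulrC.
    by rewrite /F linearP scalerDl scalerA.
  have xs : X`_i \in s by apply: mem_nth.
  suff -> : t = X`_i by [].
  apply: (scalerI c0); rewrite -[LHS]/(F t t) -gt // {1}tE.
  pose G z := sw z F; have lG : linear G by rewrite /G; lin_tac.
  rewrite -/(G _) (lin_sumE _ _ _ lG) (bigD1 i) //= big1 ?addr0 => [|j ji].
    rewrite (linZ _ _ lG) /G; have [|_ ->] := gs X`_i; first by rewrite inE xs orbT.
      by rewrite /F coord_free // eqxx scale1r.
    by [].
  rewrite (linZ _ _ lG) /G; have [|_ ->] := gs X`_j; last by [].
    by rewrite inE mem_nth ?orbT.
  by rewrite /F coord_free // (negPf ji) scale0r scaler0.
have t0 : t = 0 by rewrite tE big1 // => i _; rewrite ct scale0r.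
by have := et; rewrite t0 linear0 => /eqP; rewrite eq_sym oner_eq0.
Qed.

(** Distinct powers of x would be linearly independent, so two of the first dim H + 1 powers
    agree. *)
Lemma grouplike_order x : grouplike x -> x \is a GRing.unit ->
  exists2 N, (0 < N)%N & x ^+ N = 1.
Proof.
move=> gx ux; pose s := [seq x ^+ i | i <- iota 0 (\dim {:H}).+1].
have : ~~ uniq s.
  apply/negP => us; have fs : free s.
    by apply: grouplike_free us _ => _ /mapP[i _ ->]; apply: grouplikeX.
  have := dimvS (subvf <<s>>%VS).
  by rewrite (eqP fs) size_map size_iota ltnn.
move=> /(uniqPn 0)[i [j [ij js E]]].
have jn : (j < (\dim {:H}).+1)%N by rewrite size_map size_iota in js.
have Ex : x ^+ i = x ^+ j.
  by move: E; rewrite !(nth_map 0%N) ?size_iota ?(ltn_trans ij) // !nth_iota ?(ltn_trans ij) // !add0n.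
exists (j - i)%N; first by rewrite subn_gt0.
have uxi : x ^+ i \is a GRing.unit by rewrite unitrX.
apply: (mulrI uxi); rewrite mulr1 -exprD subnKC 1?ltnW //.
Qed.

End GroupLike.

(** * The modular element and a central power of [u] *)

Section Integral3.
Variables (K : fieldType) (charK : [pchar K] =i pred0).
Variables (H : falgType K) (Hs : hopf_algebra H) (ssH : semisimple H).
Variables (L : H) (LP : normalized_integral Hs L).
Local Notation S := (antipode Hs).
Local Notation eps := (counit Hs).
Local Notation sw := (sweedler Hs).
Local Notation chi := (regtr H).
Local Notation u := (drinfeld_elt Hs L).
Local Notation lam := (cointegral Hs L).
Let uU := drinfeld_elt_unit charK ssH LP.
Let Sinj := antipode_inj charK ssH LP.
Let Ssurj := antipode_surj charK ssH LP.
Let chiS := regtr_antipode charK ssH LP.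
Let lam_int := lam_int charK ssH LP.
Let int_lam := int_lam charK ssH LP.
Let SL := antipode_int charK ssH LP.

Lemma drinfeld_elt_antipodeSS : S (S u) = u.
Proof. by rewrite (antipodeSS charK ssH LP) mulrK. Qed.

Lemma drinfeld_elt_antipodeC : u * S u = S u * u.
Proof. by rewrite (drinfeld_eltM LP) drinfeld_elt_antipodeSS. Qed.

Lemma antipode_unit x : x \is a GRing.unit -> S x \is a GRing.unit.
Proof.
by move=> xU; apply/unitrP; exists (S x^-1); rewrite -!antipodeM mulVr ?mulrV ?antipode1.
Qed.

Lemma antipodeV x : x \is a GRing.unit -> S x^-1 = (S x)^-1.
Proof.
move=> xU; apply: (mulrI (antipode_unit xU)).
by rewrite -antipodeM mulVr // antipode1 mulrV ?antipode_unit.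
Qed.

Let SuU : S u \is a GRing.unit := antipode_unit uU.

(** Applying S to u k = S^2(k) u shows that S(u) undoes the conjugation by u. *)
Lemma drinfeld_elt_antipode_central h : u * S u * h = h * (u * S u).
Proof.
have E l : l * S u = S u * S (S l).
  by have [k ->] := Ssurj l; rewrite -!antipodeM (drinfeld_eltM LP).
have [k ->] := Ssurj h; have [l ->] := Ssurj k.
by rewrite -[LHS]mulrA -E [LHS]mulrA (drinfeld_eltM LP) -mulrA.
Qed.

Lemma lam_antipode b : lam (S b) = chi ((S u)^-1 * b).
Proof.
have E : u^-1 = S (S u)^-1 by rewrite antipodeV // drinfeld_elt_antipodeSS.
by rewrite lamE E -antipodeM chiS.
Qed.

Lemma lam_antipode_int x :
  sw x (fun a b => (lam (S b) : K) *: a) = (lam (S x) : K) *: 1.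
Proof.
apply: Sinj; rewrite (@sw_comp _ _ _ _ _ S); last by lin_tac.
under eq_sw => a b do rewrite linearZ.
rewrite linearZ /= antipode1 -lam_int sw_antipode //; by blin.
Qed.

(** By dual bases psi(x) = lam(S(psi(L_1) L_2) x), and psi(L_1) L_2 = psi(L) 1. *)
Lemma right_integral_unique (psi : 'Hom(H, K^o)) :
    (forall x, sw x (fun a b => (psi a : K) *: b) = (psi x : K) *: 1) ->
  forall x, psi x = (psi L : K) * lam x.
Proof.
move=> psiP x; rewrite -{1}[x]int_lam (@sw_comp _ _ _ _ _ psi); last by lin_tac.
transitivity (lam (S (sw L (fun a b => (psi a : K) *: b)) * x)).
  rewrite (@sw_comp _ _ _ _ _ (fun z => lam (S z * x))); last by lin_tac.
  by apply: eq_sw => a b; rewrite !linearZ /= -scalerAl linearZ /= [LHS]mulrC.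
by rewrite psiP linearZ /= antipode1 -scalerAl mul1r linearZ.
Qed.

(** The distinguished grouplike element: it measures how far lam is from being an integral on the
    other side. *)
Definition modular := sw L (fun a b => (lam b : K) *: a).
Local Notation g := modular.

Lemma lam_modular x : sw x (fun a b => (lam b : K) *: a) = (lam x : K) *: g.
Proof.
have e_basis : basis_of {:H} (vbasis {:H}) := vbasisP fullv.
(* For each functional f, the form x |-> f(x_1) lam(x_2) is again an integral, hence a multiple of
   lam. *)
suff E (f : 'Hom(H, K^o)) :
    sw x (fun a b => (lam b : K) *: f a) = (lam x : K) *: f g.
  rewrite [LHS](coord_vbasis (memvf _)) [RHS](coord_vbasis (memvf _)).
  apply: eq_bigr => i _; congr (_ *: _).
  pose f := linfun (coord (vbasis {:H}) i : H -> K^o).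
  have fE z : f z = coord (vbasis {:H}) i z by rewrite linfunE // => c y w; rewrite linearP.
  rewrite -!fE (@sw_comp _ _ _ _ _ f); last by lin_tac.
  rewrite linearZ /= -E; under eq_sw => a b do rewrite linearZ.
  by [] .
pose psi := linfun (fun x => sw x (fun a b => (lam b : K) *: f a)).
have psiE z : psi z = sw z (fun a b => (lam b : K) *: f a).
  by rewrite linfunE //; lin_tac.
rewrite -psiE (@right_integral_unique psi) => [|z].
  rewrite [LHS]mulrC psiE (@sw_comp _ _ _ _ _ f) //; last by lin_tac.
  by congr (_ * _); apply: eq_sw => a b; rewrite linearZ.
under eq_sw => p q.
  rewrite psiE (@sw_comp _ _ _ _ _ (fun c : K^o => (c : K) *: q)); last by lin_tac.
  over.
rewrite (sw_coassoc _ (f := fun a b q => (((lam b : K) *: f a : K^o) : K) *: q)); last by tlin.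
rewrite psiE (@sw_comp _ _ _ _ _ (fun c : K^o => (c : K) *: (1 : H))); last by lin_tac.
apply: eq_sw => a r.
transitivity ((f a : K) *: ((lam r : K) *: (1 : H))); last by rewrite scalerA mulrC.
rewrite -lam_int.
rewrite (@sw_comp _ _ _ _ _ (fun w => (f a : K) *: w)); last by lin_tac.
by apply: eq_sw => b q; rewrite scalerA mulrC.
Qed.

(** With k = u S(u)^-1 one has lam(S b) = lam(k b), so that 1 = L_1 lam(S(L_2)) = L_1 lam(k L_2) =
    S(k) g. *)
Lemma modularE : g = u * (S u)^-1.
Proof.
pose k := u * (S u)^-1.
have gamE b : lam (S b) = lam (k * b).
  by rewrite lam_antipode lamE [RHS]regtrC /k -!mulrA mulKr.
have := lam_antipode_int L; rewrite SL (lamL charK ssH LP) scale1r.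
under eq_sw => a b do rewrite gamE.
rewrite (sw_int_l LP _ (f := fun a b => (lam b : K) *: a)); last by blin.
under eq_sw => a b do rewrite scalerAr.
rewrite -(@sw_comp _ _ _ _ _ (fun z => S k * z)); last by lin_tac.
rewrite -/modular antipodeM antipodeV ?drinfeld_elt_antipodeSS // => E.
apply: (mulrI SuU); apply: (mulrI (_ : u^-1 \is a GRing.unit)); first by rewrite unitrV.
by rewrite !mulrA E -[_ * S u * u]mulrA -drinfeld_elt_antipodeC mulrA mulVr // mul1r mulrV.
Qed.

Lemma modular_grouplike : grouplike Hs g.
Proof.
split.
  rewrite /g (@sw_comp _ _ _ _ _ eps); last by lin_tac.
  have E a b : eps ((lam b : K) *: a) = (eps a : K) *: lam b.
    by rewrite linearZ [LHS]mulrC.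
  under eq_sw => a b do rewrite E.
  by rewrite (sw_counitl _ (f := lam)) ?(lamL charK ssH LP) //; lin_tac.
move=> W f lf; rewrite {1}/g (@sw_comp _ _ _ _ _ (fun z => sw z f)); last by lin_tac.
under eq_sw => p q.
  rewrite (@linZ _ _ _ (fun z => sw z f)); last by lin_tac.
  rewrite (@sw_comp _ _ _ _ _ (fun w => (lam q : K) *: w)); last by lin_tac.
  over.
rewrite (sw_coassoc _ (f := fun a b q => (lam q : K) *: f a b)); last by tlin.
rewrite {2}/g (@sw_comp _ _ _ _ _ (fun z => f z g)); last by lin_tac.
apply: eq_sw => a r; rewrite (@linZ _ _ _ (fun z => f z g)); last by lin_tac.
rewrite -(linZ _ _ (lf.2 a)) -lam_modular (sw_comp _ _ _ (lf.2 a)).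
by apply: eq_sw => b q; rewrite (linZ _ _ (lf.2 a)).
Qed.

Lemma drinfeld_elt_power_central : exists2 N, (0 < N)%N &
  forall h, h * u ^+ N = u ^+ N * h.
Proof.
have gU : g \is a GRing.unit by rewrite modularE unitrMl ?unitrV.
have [N N0 gN] := grouplike_order modular_grouplike gU.
(* Since u^2 = g (u S(u)) and g^N = 1, the power u^(2N) is (u S(u))^N. *)
exists (2 * N)%N; first by rewrite muln_gt0.
have -> : u ^+ (2 * N) = (u * S u) ^+ N.
  have E : u ^+ 2 = g * (u * S u).
    by rewrite modularE drinfeld_elt_antipodeC -!mulrA mulKr.
  rewrite exprM E exprMn_comm; last by rewrite /GRing.comm -drinfeld_elt_antipode_central.
  by rewrite gN mul1r.
move=> h; elim: (N) => [|n IHn]; first by rewrite expr0 mulr1 mul1r.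
by rewrite exprS mulrA -drinfeld_elt_antipode_central -mulrA IHn mulrA.
Qed.

End Integral3.

(** * The theorem of Larson and Radford *)

Section LarsonRadford.
Variables (K : closedFieldType) (charK : [pchar K] =i pred0).
Variables (H : falgType K) (Hs : hopf_algebra H) (ssH : semisimple H).
Variables (L : H) (LP : normalized_integral Hs L).
Local Notation S := (antipode Hs).
Local Notation eps := (counit Hs).
Local Notation sw := (sweedler Hs).
Local Notation chi := (regtr H).
Local Notation u := (drinfeld_elt Hs L).
Local Notation lam := (cointegral Hs L).
Local Notation n := (\dim {:H}).
Let uU := drinfeld_elt_unit charK ssH LP.
Let ndeg := regtr_nondeg charK ssH LP.

Lemma lfpow_amull (x : H) k : lfpow (amull x) k = amull (x ^+ k).
Proof.
apply/lfunP => y; rewrite lfpowE amullE; elim: k => [|k IHk]; first by rewrite mul1r.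
by rewrite iterS IHk amullE exprS mulrA.
Qed.

Lemma lam1_neq0 : lam 1 != 0.
Proof.
have [N N0 uN] := drinfeld_elt_power_central charK ssH LP.
pose v := u^-1; have vU : v \is a GRing.unit by rewrite unitrV.
have [s [szs trs eigs]] := lfun_spectrum (amull v).
have trv k : \sum_(c <- s) c ^+ k = chi (v ^+ k).
  by rewrite -trs lfpow_amull regtrE.
have vN h : h * v ^+ N = v ^+ N * h.
  have uNU : u ^+ N \is a GRing.unit by rewrite unitrX.
  apply: (mulrI uNU); apply: (mulIr uNU).
  by rewrite /v exprVn !mulrA mulrVK // mulrV // mul1r uN.
have vNk k h : h * v ^+ (N * k.+1) = v ^+ (N * k.+1) * h.
  rewrite exprM; elim: k.+1 => [|m IHm]; first by rewrite expr0 mulr1 mul1r.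
  by rewrite exprS mulrA vN -mulrA IHm mulrA.
have dim_gt0 : (0 < n)%N by rewrite lt0n dimv_eq0 -subv0; apply/negP => /subvP/(_ 1 (memvf _)); rewrite memv0 oner_eq0.
pose d (i : 'I_n) := s`_i.
have sumd k : \sum_i d i ^+ k = chi (v ^+ k).
  by rewrite -trv (big_nth 0) szs big_mkord.
have d0 i : d i != 0.
  have ds : d i \in s by apply: mem_nth; rewrite szs.
  have [x x0 vx] := eigs _ ds; apply: contraNneq x0 => di0.
  by have /eqP := vx; rewrite di0 scale0r amullE -{1}(mulr0 v) => /eqP/(mulrI vU)->.
(* Its hypothesis holds because v^(N(k+1)) is central, and multiplying it by u lowers the exponent
   by one without changing chi. *)
have := eigenvalue_sum_neq0 charK dim_gt0 N0 d0.
rewrite lamE mul1r -[u^-1]expr1 -sumd; apply=> k.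
have E m : \sum_i d i ^+ m * (d i ^+ N) ^+ k = chi (v ^+ (m + N * k)).
  by rewrite -sumd; apply: eq_bigr => i _; rewrite -exprM exprD.
rewrite !E -mulnS -(regtr_drinfeld_elt LP (vNk k)) mulnS.
have -> : (N + N * k = (N.-1 + N * k).+1)%N by rewrite -addSn prednK.
by rewrite exprS mulVKr.
Qed.

(** The sum lam(x_1) lam(S(x_2)) equals lam(S x) lam(1) by one integral property and lam(x) lam(1)
    by the other. *)
Lemma lam_antipode_eq x : lam (S x) = lam x.
Proof.
have gam1 : lam (S 1) = lam 1 by rewrite antipode1.
apply: (mulIf lam1_neq0).
have E1 := congr1 (fun z => lam (S z)) (lam_int charK ssH LP x).
have E2 := congr1 lam (lam_antipode_int charK ssH LP x).
rewrite /= !linearZ /= gam1 in E1 E2.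
rewrite -[LHS]E2 -[RHS]E1 (@sw_comp _ _ _ _ _ lam); last by lin_tac.
rewrite (@sw_comp _ _ _ _ _ (fun z => lam (S z))); last by lin_tac.
have C a b : lam ((lam (S b) : K) *: a) = lam (S ((lam a : K) *: b)).
  by rewrite !linearZ [LHS]mulrC.
by under eq_sw => a b do rewrite C.
Qed.

Lemma drinfeld_elt_antipode : S u = u.
Proof.
apply: invr_inj; apply/eqP; rewrite -subr_eq0; apply/eqP/ndeg => b.
rewrite mulrBl linearB /= -(lam_antipode charK ssH LP) lam_antipode_eq.
by rewrite lamE regtrC subrr.
Qed.

Lemma antipode4 h : S (S (S (S h))) = h.
Proof.
have := drinfeld_elt_antipode_central charK ssH LP h; rewrite drinfeld_elt_antipode => E.
rewrite !(antipodeSS charK ssH LP) !mulrA E !mulrA.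
by rewrite !mulrK.
Qed.

Lemma regtr_int : chi L = 1.
Proof.
have leps (i : 'I_1) : linear (eps : H -> K^o) by lin_tac.
rewrite regtrE (trace_rank_one leps (v := fun=> L)) => [|x].
  by rewrite big_ord1 int1.
by rewrite big_ord1 amullE (int_r LP).
Qed.

(* H (x) M is a free H-module for every H-module M; here M = H. *)
Lemma regtr_conv h : sw h (fun a b => (chi a : K) *: chi b) = n%:R * chi h.
Proof.
have chiE a : chi a = sw L (fun x y => lam (S y * (a * x))).
  rewrite regtrE (trace_lam charK ssH LP).
  by under eq_sw => x y do rewrite amullE.
have lamn z : lam z * n%:R = sw z (fun p q => (lam p : K) *: chi q).
  have -> : lam z * n%:R = chi ((lam z : K) *: 1) by rewrite linearZ /= regtr1.
  rewrite -(lam_int charK ssH LP) (@sw_comp _ _ _ _ _ chi); last by lin_tac.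
  by under eq_sw => a b do rewrite linearZ.
rewrite [in RHS]chiE mulrC.
rewrite (@sw_comp _ _ _ _ _ (fun c : K^o => (c * n%:R : K^o))); last first.
  by move=> c x y; rewrite mulrDl scalerAl.
under [RHS]eq_sw => x y.
  rewrite lamn sw_mul; last by blin.
  rewrite sw_antipode; last by blin.
  under eq_sw => y1 y2.
    rewrite sw_mul; last by blin.
    over.
  rewrite sw_exchange.
  over.
rewrite [RHS]sw_exchange; apply: eq_sw => a b; apply/esym.
under eq_sw => x y.
  rewrite sw_exchange.
  under eq_sw => x1 x2 do under eq_sw => y1 y2 do rewrite [chi (_ * (b * _))]regtrC -mulrA.
  over.
rewrite (sw_coassoc _ (f := fun x1 x2 y => sw y (fun y1 y2 =>
  (lam (S y2 * (a * x1)) : K) *: chi (b * (x2 * S y1))))); last by tlin.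
under eq_sw => x1 r.
  rewrite -(sw_coassoc _ (f := fun x2 y1 y2 =>
    (lam (S y2 * (a * x1)) : K) *: chi (b * (x2 * S y1)))); last by tlin.
  under eq_sw => m y2.
    rewrite (sw_antr _ (f := fun z => (lam (S y2 * (a * x1)) : K) *: chi (b * z))); last by lin_tac.
    rewrite mulr1; over.
  rewrite (sw_counitl _ (f := fun z => (lam (S z * (a * x1)) : K) *: chi b)); last by lin_tac.
  over.
rewrite (chiE a) (@sw_comp _ _ _ _ _ (fun c : K^o => ((c : K) *: chi b))) //.
by lin_tac.
Qed.

Lemma convSS_counit h : convSS Hs eps h = S (S h).
Proof.
rewrite convSSE (sw_counitl _ (f := fun b => S (S b))) //; by lin_tac.
Qed.

Lemma regtr_SS h : chi (S (S h)) = chi h.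
Proof. by rewrite !(regtr_antipode charK ssH LP). Qed.

(** For T = chi * S^2, the identities S^4 = id and chi * chi = n chi give T^2 = n (chi * id); one
    more T contributes another n. *)
Lemma convSS_regtr3 h :
  convSS Hs chi (convSS Hs chi (convSS Hs chi h)) = n%:R ^+ 2 *: convSS Hs chi h.
Proof.
pose T := convSS Hs chi.
pose E h := sw h (fun a b => (chi a : K) *: b).
have convE f (lf : linear f) z : sw z (fun a b => (chi a : K) *: sw b (fun p q => (chi p : K) *: f q)) =
    n%:R *: sw z (fun a b => (chi a : K) *: (f b : H)).
  rewrite (@sw_comp _ _ _ _ _ (fun w => n%:R *: w)); last by lin_tac.
  under eq_sw => a b.
    rewrite (@sw_comp _ _ _ _ _ (fun w => (chi a : K) *: w)); last by lin_tac.
    over.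
  rewrite -(sw_coassoc _ (f := fun a p q => (chi a : K) *: ((chi p : K) *: f q))); last by tlin.
  apply: eq_sw => r q.
  transitivity (((sw r (fun a p => (chi a : K) *: chi p) : K^o) : K) *: f q).
    rewrite (@sw_comp _ _ _ _ _ (fun c : K^o => (c : K) *: f q)); last by lin_tac.
    by apply: eq_sw => a p; rewrite scalerA.
  by rewrite regtr_conv scalerA.
have TT z : T (T z) = n%:R *: E z.
  rewrite /T [X in convSS _ _ X]convSSE (@sw_comp _ _ _ _ _ T); last by lin_tac.
  under eq_sw => a b.
    rewrite linearZ /= /T convSSE !sw_antipode; [|by blin|by blin].
    under eq_sw => p q do rewrite regtr_SS antipode4.
    over.
  by rewrite -(convE id).
rewrite -/T (TT h) linearZ /= /E (@sw_comp _ _ _ _ _ T); last by lin_tac.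
under eq_sw => a b do rewrite linearZ /= /T convSSE.
rewrite (convE (fun b => S (S b))); last by lin_tac.
by rewrite convSSE scalerA.
Qed.

(* The eigenvalues of chi * S^2 are 0, n and -n. *)
Lemma lam1_integral : exists t : int, lam 1 = n%:R * t%:~R.
Proof.
have [s [szs trs eigs]] := lfun_spectrum (convSS Hs chi).
have := trs 1%N; rewrite /lfpow /= comp_lfun1l.
rewrite (trace_convSS charK ssH LP) regtr_int mul1r => ->.
have cs c : c \in s -> exists t : int, c = n%:R * t%:~R.
  move=> /eigs[v v0 vE].
  have Td e : convSS Hs chi (e *: v) = (e * c) *: v by rewrite linearZ /= vE scalerA.
  have /eqP := convSS_regtr3 v.
  rewrite vE !Td scalerA -subr_eq0 -scalerBl scaler_eq0 (negPf v0) orbF.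
  have -> : c * c * c - n%:R ^+ 2 * c = c * ((c - n%:R) * (c + n%:R)) :> K by ring.
  rewrite !mulf_eq0 subr_eq0 addr_eq0 => /or3P[] /eqP ->.
  - by exists 0; rewrite mulr0.
  - by exists 1; rewrite mulr1.
  - by exists (-1); rewrite rmorphN1 mulrN1.
elim: s cs {szs trs eigs} => [|c s IHs] cs.
  by exists 0; rewrite big_nil mulr0.
have [t1 t1E] : exists t : int, c = n%:R * t%:~R by apply: cs; rewrite mem_head.
have [t2 t2E] : exists t : int, \sum_(c <- s) c ^+ 1 = n%:R * t%:~R.
  by apply: IHs => x xs; apply: cs; rewrite inE xs orbT.
by exists (t1 + t2); rewrite big_cons t2E expr1 t1E intrD mulrDr.
Qed.

Lemma antipode_involutive h : S (S h) = h.
Proof.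
have /pcharf0P char0 := charK.
have n2 : (2%:R : K) != 0 by rewrite char0.
pose SS := (S \o S)%VF : 'End(H).
have SSE x : SS x = S (S x) by rewrite comp_lfunE.
have trSS : trace SS = lam 1.
  have <- : convSS Hs eps = SS by apply/lfunP => x; rewrite convSS_counit SSE.
  by rewrite (trace_convSS charK ssH LP) int1 // mul1r.
pose P e : 'End(H) := 2%:R^-1 *: (\1 + e *: SS)%VF.
have PE e x : P e x = 2%:R^-1 *: (x + e *: S (S x)).
  by rewrite scale_lfunE add_lfunE id_lfunE scale_lfunE SSE.
have PP e : e ^+ 2 = 1 -> forall x, P e (P e x) = P e x.
  move=> e2 x; rewrite !PE; set y := x + e *: S (S x).
  have ySS : e *: S (S y) = y.
    by rewrite /y -SSE linearD /= linearZ /= !SSE antipode4 scalerDr scalerA -expr2 e2 scale1r addrC.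
  congr (_ *: _); rewrite -SSE linearZ /= SSE scalerA mulrC -scalerA ySS -scalerDl.
  by rewrite -[RHS]scale1r; congr (_ *: _); field.
have trP e : trace (P e) = 2%:R^-1 * (n%:R + e * lam 1).
  have tr1 : trace (\1%VF : 'End(H)) = n%:R.
    have -> : \1%VF = amull (1 : H) by apply/lfunP => x; rewrite id_lfunE amullE mul1r.
    by rewrite -regtrE regtr1.
  pose f : 'End(H) := 0.
  have Z c (g : 'End(H)) : trace (c *: g) = c * trace g.
    have := trace_is_linear c g f; have := trace_is_linear (-1) f f.
    rewrite /f scaler0 addr0 scaleN1r addNr => -> ; rewrite !addr0.
    by [].
  by rewrite Z addrC trace_is_linear tr1 trSS addrC.
have [a aE] : exists a : nat, trace (P (-1)) = a%:R.
  by eexists; rewrite trace_idempotent //; apply: PP; rewrite sqrrN expr1n.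
have [b bE] : exists b : nat, trace (P 1) = b%:R.
  by eexists; rewrite trace_idempotent //; apply: PP; rewrite expr1n.
have [t tE] := lam1_integral.
have abn : (a + b)%:R = n%:R :> K.
  by rewrite natrD -aE -bE !trP; field.
have abl : b%:R - a%:R = lam 1 by rewrite -aE -bE !trP; field.
have tt : (b%:Z - a%:Z - (a + b)%:Z * t == 0).
  by rewrite -(char0_intr_eq0 charK) !rmorphB rmorphM /= -!pmulrn abl tE abn subrr.
have t0 : t != 0.
  by apply: contraNneq lam1_neq0 => t0; rewrite tE t0 mulr0.
(* The ranks a and b of the projections for the eigenvalues -1 and 1 satisfy b - a = (a + b) t with
   t nonzero. *)
have [a0|b0] : a = 0%N \/ b = 0%N by nia.
  have : P (-1) = 0 by apply: (idempotent_trace0 charK); [apply: PP; rewrite sqrrN expr1n | rewrite aE a0].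
  move=> /lfunP/(_ h); rewrite PE zero_lfunE => /eqP.
  by rewrite scaler_eq0 invr_eq0 (negPf n2) /= scaleN1r subr_eq0 => /eqP.
have : P 1 = 0 by apply: (idempotent_trace0 charK); [apply: PP; rewrite expr1n | rewrite bE b0].
move=> /lfunP/(_ 1); rewrite PE zero_lfunE !antipode1 scale1r => /eqP.
have -> : 1 + 1 = 2%:R *: 1 :> H by rewrite scaler_nat.
rewrite scaler_eq0 invr_eq0 (negPf n2) /=.
by rewrite scaler_eq0 (negPf n2) oner_eq0.
Qed.

End LarsonRadford.

(** * Consequences of [S^2 = id] *)

Section Involutive.
Variables (K : closedFieldType) (charK : [pchar K] =i pred0).
Variables (H : falgType K) (Hs : hopf_algebra H) (ssH : semisimple H).
Variables (L : H) (LP : normalized_integral Hs L).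
Local Notation S := (antipode Hs).
Local Notation eps := (counit Hs).
Local Notation sw := (sweedler Hs).
Local Notation chi := (regtr H).
Local Notation u := (drinfeld_elt Hs L).
Local Notation lam := (cointegral Hs L).
Local Notation n := (\dim {:H}).
Let SS := antipode_involutive charK ssH LP.

Lemma lamC a b : lam (a * b) = lam (b * a).
Proof.
have uC h : h * u^-1 = u^-1 * h.
  have uU := drinfeld_elt_unit charK ssH LP.
  by apply: (mulrI uU); apply: (mulIr uU); rewrite !mulrA mulrVK // mulrV // mul1r (drinfeld_eltM LP) SS.
by rewrite !lamE -mulrA regtrC -[LHS]/(chi _) -mulrA -uC mulrA.
Qed.

(** Write phi as lam(- h). Then phi(L_1) L_2 = S(h), while L_1 phi(L_2) = S(h) g with g = 1. *)
Lemma int_cocomm (phi psi : 'Hom(H, K^o)) :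
  sw L (fun a b => (phi a : K) *: psi b) = sw L (fun a b => (phi b : K) *: psi a).
Proof.
have [h phiE] : exists h, forall x, phi x = lam (x * h).
  exists (sw L (fun p q => (phi p : K) *: S q)) => x.
  rewrite -{1}[x](int_lam charK ssH LP) (@sw_comp _ _ _ _ _ phi); last by lin_tac.
  rewrite lamC (@sw_comp _ _ _ _ _ (fun z => lam (z * x))); last by lin_tac.
  have E a b : phi ((lam (S b * x) : K) *: a) = lam ((phi a : K) *: S b * x).
    by rewrite -scalerAl !linearZ [LHS]mulrC.
  by under eq_sw => a b do rewrite E.
have g1 : modular Hs L = 1.
  by rewrite (modularE charK ssH LP) (drinfeld_elt_antipode charK ssH LP) mulrV // (drinfeld_elt_unit charK ssH LP).
have comp (f : H -> H -> K^o) (g : H -> H -> H) :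
    (forall a b, psi (g a b) = f a b) -> sw L f = psi (sw L g).
  move=> E; rewrite (@sw_comp _ _ _ _ _ psi); last by lin_tac.
  by under [RHS]eq_sw => a b do rewrite E.
rewrite (comp _ (fun a b => (phi a : K) *: b)) => [|a b]; last exact: linearZ.
rewrite (comp _ (fun a b => (phi b : K) *: a)) => [|a b]; last exact: linearZ.
congr (psi _).
under eq_sw => a b do rewrite phiE.
rewrite (int_lam_l charK ssH LP).
under eq_sw => a b do rewrite phiE lamC.
rewrite (sw_int_l LP _ (f := fun a b => (lam b : K) *: a)); last by blin.
under eq_sw => a b do rewrite scalerAr.
rewrite -(@sw_comp _ _ _ _ _ (fun z => S h * z)); last by lin_tac.
by rewrite -/(modular Hs L) g1 mulr1.
Qed.

(* Conjugation by the antipode turns h |-> h_1 phi(h_2) into the operators of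
   [trace_convSS]. *)
Lemma trace_conv (phi : 'Hom(H, K^o)) (F : 'End(H)) :
  (forall h, F h = sw h (fun a b => (phi b : K) *: a)) ->
  trace F = n%:R * phi L.
Proof.
move=> FE; have lam1 : lam 1 = n%:R.
  have := trace_convSS charK ssH LP eps; rewrite int1 // mul1r => <-.
  have -> : convSS Hs eps = amull 1.
    by apply/lfunP => x; rewrite convSS_counit SS amullE mul1r.
  by rewrite -regtrE regtr1.
have -> : trace F = trace (S \o (F \o S))%VF.
  rewrite trace_compC; congr (trace _); apply/lfunP => x.
  by rewrite !comp_lfunE SS.
have -> : (S \o (F \o S))%VF = convSS Hs (phi \o S)%VF.
  apply/lfunP => x; rewrite convSSE !comp_lfunE FE sw_antipode; last by blin.
  rewrite (@sw_comp _ _ _ _ _ S); last by lin_tac.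
  by apply: eq_sw => a b; rewrite linearZ comp_lfunE.
by rewrite (trace_convSS charK ssH LP) comp_lfunE (antipode_int charK ssH LP) lam1 mulrC.
Qed.

(** Exponents are defined with S^-2 tau and indicators with tau; here the two meet. *)
Lemma sigma_twist_id (tau : 'End(H)) : sigma_twist Hs tau = tau.
Proof.
have kS : lker S == 0%VS.
  rewrite -subv0; apply/subvP => x; rewrite memv_ker memv0 => /eqP Sx.
  by rewrite -[x]SS Sx linear0.
have SVE y : (S^-1)%VF y = S y by rewrite -{1}[y]SS lker0_lfunK.
by apply/lfunP => x; rewrite !comp_lfunE !SVE SS.
Qed.

End Involutive.

(** * Twisted powers *)

Lemma tensor_pure (K : fieldType) (U V : vectType K) (t : tensor U V) :
  t = tlift (fun u v => pure u v) t.
Proof.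
have cE (X : vectType K) (k l : 'I_(\dim {:X})) :
    coord (vbasis {:X}) k (vbasis {:X})`_l = (l == k)%:R.
  by rewrite coord_free // (basis_free (vbasisP _)).
rewrite tliftE; apply/matrixP => i j; rewrite summxE (bigD1 i) //= summxE.
rewrite (bigD1 j) //= [X in _ + X + _]big1 ?[X in _ + X]big1 ?addr0.
- by rewrite !mxE !cE !eqxx !mulr1.
- move=> l li; rewrite summxE big1 // => k _.
  by rewrite !mxE !cE (negPf li) mul0r mulr0.
- by move=> l lj; rewrite !mxE !cE (negPf lj) !mulr0.
Qed.

Lemma lin_ext_tensor (K : fieldType) (U V W : vectType K)
    (f g : tensor U V -> W) :
  linear f -> linear g -> (forall u v, f (pure u v) = g (pure u v)) ->
  forall t, f t = g t.
Proof.
move=> lf lg fg t; rewrite [t]tensor_pure !(tlift_comp _ _ lf, tlift_comp _ _ lg).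
exact: eq_tlift.
Qed.

Section TwistedPower.
Variables (K : fieldType) (H : falgType K) (Hs : hopf_algebra H).
Variables (tau : 'End(H)) (tauP : hopf_automorphism Hs tau).
Local Notation eps := (counit Hs).
Local Notation sw := (sweedler Hs).

Lemma auto1 : tau 1 = 1. Proof. by case: tauP => _ []. Qed.
Lemma autoM a b : tau (a * b) = tau a * tau b. Proof. by case: tauP => _ [] _ ->. Qed.
Lemma auto_counit h : eps (tau h) = eps h. Proof. by case: tauP. Qed.

Lemma sw_auto (W : vectType K) (f : H -> H -> W) h : bilin f ->
  sw (tau h) f = sw h (fun a b => f (tau a) (tau b)).
Proof.
move=> lf; case: tauP => _ _ _ tauD _; rewrite /sweedler tauD /tmap.
rewrite (tlift_comp (F := tlift f)); last by lin_tac.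
by apply: eq_tlift => a b; rewrite tlift_pureE.
Qed.

Lemma auto_int L : normalized_integral Hs L -> tau L = L.
Proof.
move=> LP; case: (tauP) => [[ti tiK Kti] _ _ _ _].
have left h : h * tau L = (eps h : K) *: tau L.
  by rewrite -[h]Kti -autoM (int_l LP) linearZ /= auto_counit.
have := left L; rewrite int1 // scale1r => <-.
by rewrite (int_r LP) auto_counit int1 // scale1r.
Qed.

(* For m = 0 this is the unit of the convolution algebra, not h, which makes the
   recursion uniform. *)
Fixpoint conv_twisted (i m : nat) (h : H) : H :=
  if m is m'.+1 then sw h (fun a b => lfpow tau i a * conv_twisted i.+1 m' b)
  else (eps h : K) *: 1.

Lemma lin_conv_twisted i m : linear (conv_twisted i m).
Proof.
elim: m i => [|m IHm] i; first by rewrite /=; lin_tac.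
have := IHm i.+1 => l; rewrite /=; lin_tac.
Qed.

Lemma lin_iter_comul m : linear (iter_comul Hs m).
Proof. by case: m => [|m]; rewrite /=; lin_tac. Qed.

Lemma lin_twisted_prod i m : linear (twisted_prod tau i (n := m)).
Proof.
case: m => [|m]; last by rewrite /=; lin_tac.
by move=> c x y; rewrite /= -!lfpowE linearP.
Qed.

(** The left side counts comultiplications and the right side factors, hence the shift by one. *)
Lemma twisted_prodE i m h :
  twisted_prod tau i (iter_comul Hs m h) = conv_twisted i m.+1 h.
Proof.
elim: m i h => [|m IHm] i h.
  rewrite /= -lfpowE -[LHS](sw_counitr Hs (f := lfpow tau i)); last by lin_tac.
  by apply: eq_sw => a b; rewrite -scalerAr mulr1.
have lI := lin_iter_comul m; have lT := @lin_twisted_prod i.+1 m.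
rewrite /= [tmap _ _ _](_ : _ = sw h (fun a b => pure a (iter_comul Hs m b))) //.
rewrite (tlift_comp (F := tlift _)); last by lin_tac.
apply: eq_tlift => a b; rewrite tlift_pureE.
  by rewrite IHm -lfpowE.
split=> v; last by lin_tac.
by move=> c x y; rewrite -!lfpowE linearP mulrDl scalerAl.
Qed.

Lemma twisted_powerE m h : (0 < m)%N -> twisted_power Hs tau m h = conv_twisted 0 m h.
Proof. by case: m => // m _; rewrite /twisted_power twisted_prodE. Qed.

Lemma conv_twisted_auto i m h : conv_twisted i m (tau h) = tau (conv_twisted i m h).
Proof.
elim: m i h => [|m IHm] i h /=; first by rewrite auto_counit linearZ /= auto1.
have l := lin_conv_twisted i.+1 m.
rewrite sw_auto; last by blin.
rewrite (@sw_comp _ _ _ _ _ tau); last by lin_tac.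
apply: eq_sw => a b; rewrite autoM IHm; congr (_ * _).
by rewrite !lfpowE; apply/esym/iterSr.
Qed.

Lemma conv_twisted_shift i m h : conv_twisted i.+1 m h = conv_twisted i m (tau h).
Proof.
elim: m i h => [|m IHm] i h /=; first by rewrite auto_counit.
have l := lin_conv_twisted i.+1 m; rewrite sw_auto; last by blin.
by apply: eq_sw => a b; rewrite IHm comp_lfunE.
Qed.

Section Operator.
Variables (t : 'End(H)) (tK : cancel t tau) (Kt : cancel tau t).
Variables (V : vectType K) (rho : 'Hom(H, 'End(V))) (rhoP : representation rho).

Lemma sw_autoV (W : vectType K) (f : H -> H -> W) h : bilin f ->
  sw (t h) f = sw h (fun a b => f (t a) (t b)).
Proof.
move=> lf; rewrite -[in RHS](tK h) sw_auto; last by blin.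
by apply: eq_sw => a b; rewrite !Kt.
Qed.

Definition twisted_op : 'End(tensor H V) :=
  tlift (fun h v => sw h (fun a b => pure (t a) (rho (t b) v))).

Lemma twisted_op_pure h v :
  twisted_op (pure h v) = sw h (fun a b => pure (t a) (rho (t b) v)).
Proof.
by rewrite /twisted_op tlift_pureE //; split=> w; lin_tac.
Qed.

Lemma autoVM a b : t (a * b) = t a * t b.
Proof. by apply: (can_inj Kt); rewrite autoM !tK. Qed.

Lemma lfpowS (U : vectType K) (f : 'End(U)) m x : lfpow f m.+1 x = f (lfpow f m x).
Proof. by rewrite !lfpowE. Qed.

Lemma sw_autoVX (W : vectType K) (f : H -> H -> W) m h : bilin f ->
  sw (lfpow t m h) f = sw h (fun a b => f (lfpow t m a) (lfpow t m b)).
Proof.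
elim: m f => [|m IHm] f lf; first by rewrite /lfpow /= id_lfunE; apply: eq_sw => a b; rewrite !id_lfunE.
rewrite lfpowS sw_autoV // IHm; last by blin.
by apply: eq_sw => a b; rewrite !lfpowS.
Qed.

Lemma autoVXM m a b : lfpow t m (a * b) = lfpow t m a * lfpow t m b.
Proof.
elim: m a b => [|m IHm] a b; first by rewrite /lfpow /= !id_lfunE.
by rewrite !lfpowS IHm autoVM.
Qed.

(** Every application twists the factors split off later by one more tau^-1. Up to a common tau^-m
    this is the required pattern of twists, and that common twist vanishes when r divides m. *)
Lemma twisted_op_iter m h v : lfpow twisted_op m (pure h v) =
  sw h (fun a b => pure (lfpow t m a) (rho (lfpow t m (conv_twisted 0 m b)) v)).
Proof.
elim: m => [|m IHm].
  rewrite /lfpow /= id_lfunE.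
  rewrite -[LHS](sw_counitr Hs (f := fun z => pure z v)); last by lin_tac.
  apply: eq_sw => a b; rewrite !id_lfunE linearZ /= rhoP.1 scale_lfunE id_lfunE.
  by apply/matrixP => i j; rewrite !mxE linearZ mulrCA.
have lX := lin_conv_twisted 0 m; have lX1 := lin_conv_twisted 1 m.
rewrite lfpowS IHm (@sw_comp _ _ _ _ _ twisted_op); last by lin_tac.
under eq_sw => a b.
  rewrite twisted_op_pure sw_autoVX; last by blin.
  over.
rewrite (sw_coassoc _ (f := fun p q b => pure (t (lfpow t m p))
  (rho (t (lfpow t m q)) (rho (lfpow t m (conv_twisted 0 m b)) v)))); last by tlin.
apply: eq_sw => a r.
rewrite [conv_twisted 0 m.+1 r]/= (@sw_comp _ _ _ _ _ (fun z => pure (lfpow t m.+1 a) (rho (lfpow t m.+1 z) v))); last by lin_tac.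
have tX y : lfpow t m.+1 (tau y) = lfpow t m y by rewrite !lfpowE iterSr Kt.
apply: eq_sw => q b; rewrite id_lfunE conv_twisted_shift conv_twisted_auto autoVXM rhoP.2 comp_lfunE.
by rewrite tX !lfpowS.
Qed.

End Operator.
End TwistedPower.

Lemma trace_tensor (K : fieldType) (U V : vectType K) (A : 'End(tensor U V)) :
  trace A = \sum_(i < \dim {:U}) \sum_(j < \dim {:V})
    (A (pure (vbasis {:U})`_i (vbasis {:V})`_j) : 'M[K]_(_, _)) i j.
Proof.
pose phi (p : 'I_(\dim {:U}) * 'I_(\dim {:V})) (x : tensor U V) : K^o :=
  (x : 'M[K]_(_, _)) p.1 p.2.
have lphi p : linear (phi p) by move=> c x y; rewrite /phi !mxE.
rewrite (trace_rank_one lphi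
   (v := fun p : 'I__ * 'I__ => A (pure (vbasis {:U})`_p.1 (vbasis {:V})`_p.2))).
  by rewrite pair_big.
move=> x; rewrite {1}[x]tensor_pure (tlift_comp (F := A)); last by lin_tac.
by rewrite tliftE pair_big.
Qed.

(** * Order and traces of the operator on H (x) V *)

Section Regular.
Variables (K : closedFieldType) (charK : [pchar K] =i pred0).
Variables (H : falgType K) (Hs : hopf_algebra H) (ssH : semisimple H).
Variables (L : H) (LP : normalized_integral Hs L).
Variables (tau : 'End(H)) (tauP : hopf_automorphism Hs tau).
Variables (r : nat) (r_gt0 : (0 < r)%N) (tau_r : forall h, iter r tau h = h).
Variables (V : vectType K) (rho : 'Hom(H, 'End(V))) (rhoP : representation rho).
Local Notation eps := (counit Hs).
Local Notation sw := (sweedler Hs).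
Local Notation conv_twisted := (conv_twisted Hs tau 0).
Local Notation t := (lfpow tau r.-1).
Local Notation F := (twisted_op Hs t rho).

Lemma autoK : cancel tau t.
Proof. by move=> h; rewrite lfpowE -iterSr prednK. Qed.

Lemma autoVK : cancel t tau.
Proof. by move=> h; rewrite lfpowE -iterS prednK. Qed.

Lemma iter_auto m h : (r %| m)%N -> lfpow tau m h = h.
Proof.
move=> /dvdnP[k ->]; rewrite lfpowE; elim: k => // k IHk.
by rewrite mulSn iterD IHk tau_r.
Qed.

Lemma iter_autoV m h : (r %| m)%N -> lfpow t m h = h.
Proof.
move=> rm; rewrite -{1}(iter_auto h rm) !lfpowE; elim: m h {rm} => // m IHm h.
by rewrite iterSr -[X in t X]/(iter m.+1 tau h) iterS autoK IHm.
Qed.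

Lemma twisted_op_dvd m h v : (r %| m)%N ->
  lfpow F m (pure h v) = sw h (fun a b => pure a (rho (conv_twisted m b) v)).
Proof.
move=> rm; rewrite (twisted_op_iter tauP autoVK autoK rhoP).
by apply: eq_sw => a b; rewrite !iter_autoV.
Qed.

(** The counit on the first tensor factor recovers the action on V, so exponents of V become
    exponents of one operator. *)
Lemma twisted_op_id m : (r %| m)%N ->
    (forall h, rho (conv_twisted m h) = (eps h : K) *: \1%VF) <->
    (forall x, lfpow F m x = x).
Proof.
move=> rm; split=> [E|E h].
  apply: lin_ext_tensor => [||h v]; [by lin_tac|by lin_tac|].
  rewrite twisted_op_dvd // -[RHS](sw_counitr Hs (f := fun z => pure z v)); last by lin_tac.
  apply: eq_sw => a b; rewrite E scale_lfunE id_lfunE.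
  by apply/matrixP => i j; rewrite !mxE linearZ mulrCA.
apply/lfunP => v; have l := lin_conv_twisted Hs tau 0 m.
pose G : 'Hom(tensor H V, V) := tlift (fun h v => (eps h : K) *: v).
have bG : bilin (fun (h : H) (v : V) => (eps h : K) *: v) by blin.
have := congr1 G (E (pure h v)); rewrite twisted_op_dvd // (@sw_comp _ _ _ _ _ G); last by lin_tac.
rewrite /G (tlift_pureE _ _ bG) scale_lfunE id_lfunE => <-.
under eq_sw => a b do rewrite (tlift_pureE _ _ bG).
by rewrite (sw_counitl _ (f := fun z => rho (conv_twisted m z) v)) //; lin_tac.
Qed.

(** The partial trace over V is the operator h |-> h_1 phi(h_2) on H, for phi the trace of the m-th
    twisted power on V; [trace_conv] applies. *)
Lemma trace_twisted_op m : (r %| m)%N ->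
  trace (lfpow F m) = (\dim {:H})%:R * character rho (conv_twisted m L).
Proof.
move=> rm; have l := lin_conv_twisted Hs tau 0 m.
have lphi : linear (fun b => trace (rho (conv_twisted m b)) : K^o).
  move=> c x y; rewrite l linearP; exact: trace_is_linear.
pose phi : 'Hom(H, K^o) := linfun (fun b => trace (rho (conv_twisted m b)) : K^o).
have phiE b : phi b = trace (rho (conv_twisted m b)) by rewrite linfunE.
pose G : 'End(H) := linfun (fun h => sw h (fun a b => (phi b : K) *: a)).
have GE h : G h = sw h (fun a b => (phi b : K) *: a) by rewrite linfunE //; lin_tac.
rewrite /character -phiE -(trace_conv charK ssH LP GE) trace_tensor traceE.
apply: eq_bigr => i _; rewrite GE.
pose ci := linfun (coord (vbasis {:H}) i : H -> K^o).
have ciE z : ci z = coord (vbasis {:H}) i z by rewrite linfunE // => c y w; rewrite linearP.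
rewrite -ciE (@sw_comp _ _ _ _ _ ci); last by lin_tac.
transitivity (\sum_j sw (vbasis {:H})`_i (fun a b =>
   ((coord (vbasis {:V}) j (rho (conv_twisted m b) (vbasis {:V})`_j)) *: ci a : K^o))).
  apply: eq_bigr => j _; rewrite twisted_op_dvd //.
  pose q (x : tensor H V) : K^o := (x : 'M[K]_(_, _)) i j.
  have lq : linear q by move=> c x y; rewrite /q !mxE.
  rewrite -/(q _) (sw_comp _ _ _ lq).
  have E a b : q (pure a (rho (conv_twisted m b) (vbasis {:V})`_j)) =
      coord (vbasis {:V}) j (rho (conv_twisted m b) (vbasis {:V})`_j) *: ci a.
    by rewrite /q mxE ciE [LHS]mulrC.
  by under eq_sw => a b do rewrite E.
rewrite /sweedler; under eq_bigr => j _ do rewrite tliftE.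
rewrite tliftE exchange_big; apply: eq_bigr => p _; rewrite exchange_big.
apply: eq_bigr => s _ /=; rewrite -scaler_sumr -scaler_suml.
have -> : \sum_(j < \dim {:V}) coord (vbasis {:V}) j
    (rho (conv_twisted m (vbasis {:H})`_s) (vbasis {:V})`_j) = phi (vbasis {:H})`_s.
  by rewrite phiE traceE.
have E z : ci ((phi z : K) *: (vbasis {:H})`_p) = phi z *: ci (vbasis {:H})`_p.
  exact: linearZ.
by rewrite E.
Qed.

End Regular.

(** * The cyclic shift *)

(* [eq_sw] does not unify with equations in K, since K^o, not K, is a vectType. *)
Definition eq_swK (K : fieldType) (H : falgType K) (Hs : hopf_algebra H) := @eq_sw K H Hs K^o.
Arguments eq_swK {K H Hs}.

Lemma big_tuple_cons (R : nmodType) (I : finType) n (F : n.+1.-tuple I -> R) :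
  \sum_z F z = \sum_x \sum_(z : n.-tuple I) F [tuple of x :: z].
Proof.
rewrite pair_big /= (reindex (fun p : I * n.-tuple I => [tuple of p.1 :: p.2])) //=.
exists (fun z : n.+1.-tuple I => (thead z, [tuple of behead z])) => [[x z]|z] _ /=.
  by congr pair; apply: val_inj.
by rewrite -tuple_eta.
Qed.

Lemma sum_sw (K : fieldType) (H : falgType K) (Hs : hopf_algebra H)
    (W : vectType K) (I : finType) h (f : I -> H -> H -> W) :
  \sum_i sweedler Hs h (f i) = sweedler Hs h (fun a c => \sum_i f i a c).
Proof.
rewrite /sweedler tliftE; under eq_bigr => j _ do rewrite tliftE.
rewrite exchange_big; apply: eq_bigr => p _; rewrite exchange_big.
by apply: eq_bigr => q _; rewrite scaler_sumr.
Qed.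

Section Coefficients.
Variables (K : closedFieldType) (charK : [pchar K] =i pred0).
Variables (H : falgType K) (Hs : hopf_algebra H) (ssH : semisimple H).
Variables (L : H) (LP : normalized_integral Hs L).
Variables (tau : 'End(H)) (tauP : hopf_automorphism Hs tau).
Variables (r : nat) (r_gt0 : (0 < r)%N) (tau_r : forall h, iter r tau h = h).
Variables (V : vectType K) (rho : 'Hom(H, 'End(V))) (rhoP : representation rho).
Local Notation eps := (counit Hs).
Local Notation sw := (sweedler Hs).
Local Notation conv_twisted := (conv_twisted Hs tau).
Local Notation d := (\dim {:V}).
Local Notation b := (vbasis {:V}).

Definition mcoef (p q : 'I_d) : 'Hom(H, K^o) :=
  linfun (fun h => coord b p (rho h b`_q) : K^o).

Lemma mcoefE p q h : mcoef p q h = coord b p (rho h b`_q).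
Proof.
by rewrite linfunE // => c x y; rewrite linearP add_lfunE scale_lfunE linearP.
Qed.

Lemma mcoefM p q h k : mcoef p q (h * k) = \sum_s (mcoef p s h : K) * mcoef s q k.
Proof.
rewrite mcoefE rhoP.2 comp_lfunE [rho k _](coord_vbasis (memvf _)).
rewrite linear_sum linear_sum; apply: eq_bigr => s _.
by rewrite linearZ linearZ !mcoefE mulrC.
Qed.

(* Matrix coefficients of V (x) V^tau (x) V^(tau^2) (x) ..., the twists starting
   at tau^i. *)
Fixpoint tcoef (i : nat) (xs ys : seq 'I_d) (h : H) : K^o :=
  match xs, ys with
  | x :: xs', y :: ys' =>
      sw h (fun a c => (mcoef x y (lfpow tau i a) : K) *: tcoef i.+1 xs' ys' c)
  | [::], [::] => eps h
  | _, _ => 0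
  end.

Lemma lin_tcoef i xs ys : linear (tcoef i xs ys).
Proof.
elim: xs ys i => [|x xs IHxs] [|y ys] i /=.
- by lin_tac.
- by move=> c h k; rewrite scaler0 addr0.
- by move=> c h k; rewrite scaler0 addr0.
by have l := IHxs ys i.+1; lin_tac.
Qed.

Lemma autoXM i x y : lfpow tau i (x * y) = lfpow tau i x * lfpow tau i y.
Proof.
rewrite !lfpowE; elim: i => //= i ->; exact: (autoM tauP).
Qed.

Lemma tcoefM n i (xs ys : n.-tuple 'I_d) h k :
  tcoef i xs ys (h * k) =
  \sum_(zs : n.-tuple 'I_d) (tcoef i xs zs h : K) * tcoef i zs ys k.
Proof.
elim: n i xs ys h k => [|n IHn] i xs ys h k.
  rewrite (big_pred1 [tuple]) => [|zs]; last by rewrite [zs]tuple0; apply/esym/eqP.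
  by rewrite [xs]tuple0 [ys]tuple0 /= counitM.
case/tupleP: xs => x xs; case/tupleP: ys => y ys /=.
have l := lin_tcoef i.+1 xs ys.
rewrite sw_mul; last by blin.
rewrite big_tuple_cons /=.
under eq_sw => a1 a2.
  under eq_sw => b1 b2.
    rewrite autoXM mcoefM IHn; over.
  over.
have E1 s (zs : n.-tuple 'I_d) :
    (sw h (fun a1 a2 => (mcoef x s (lfpow tau i a1) : K) *: tcoef i.+1 xs zs a2) : K) *
    sw k (fun b1 b2 => (mcoef s y (lfpow tau i b1) : K) *: tcoef i.+1 zs ys b2) =
    sw h (fun a1 a2 => sw k (fun b1 b2 =>
     ((mcoef x s (lfpow tau i a1) : K) * mcoef s y (lfpow tau i b1)) *:
     ((tcoef i.+1 xs zs a2 : K) * tcoef i.+1 zs ys b2 : K^o))).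
  rewrite (@sw_comp _ _ _ _ _ (fun w : K^o => ((w : K) *
     sw k (fun b1 b2 => (mcoef s y (lfpow tau i b1) : K) *: tcoef i.+1 zs ys b2) : K^o))); last first.
    by move=> c w w'; rewrite mulrDl; congr (_ + _); exact/esym/mulrA.
  apply: eq_swK => a1 a2.
  rewrite (@sw_comp _ _ _ _ _ (fun w : K^o =>
     ((mcoef x s (lfpow tau i a1) *: tcoef i.+1 xs zs a2 : K^o) : K) * (w : K) : K^o)); last first.
    by move=> c w w'; rewrite mulrDr; congr (_ + _); exact: mulrCA.
  by apply: eq_swK => b1 b2; exact: mulrACA.
under [RHS]eq_bigr => s _ do under eq_bigr => zs _ do rewrite E1.
rewrite pair_big (@sum_sw K H Hs K^o); apply: eq_swK => a1 a2; rewrite (@sum_sw K H Hs K^o); apply: eq_swK => b1 b2.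
rewrite scaler_suml -(pair_big xpredT xpredT (fun s (zs : n.-tuple 'I_d) => (mcoef x s (lfpow tau i a1) : K) * mcoef s y (lfpow tau i b1) *:
     ((tcoef i.+1 xs zs a2 : K) * tcoef i.+1 zs ys b2 : K^o))) /=.
by apply: eq_bigr => s _; rewrite scaler_sumr.
Qed.

(** A product of n + 1 matrices is a sum over paths from x to y. When y = x, the column index is the
    rotated row index. *)
Lemma tcoef_conv_twisted n i x y h :
  mcoef x y (conv_twisted i n.+1 h) =
  \sum_(zs : n.-tuple 'I_d) tcoef i (x :: zs) (rcons zs y) h.
Proof.
elim: n i x h => [|n IHn] i x h.
  rewrite (big_pred1 [tuple]) => [|zs]; last by rewrite [zs]tuple0; apply/esym/eqP.
  rewrite /= (@sw_comp _ _ _ _ _ (mcoef x y)); last by lin_tac.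
  by apply: eq_swK => a c; rewrite -scalerAr linearZ mulr1 [LHS]mulrC.
have -> : conv_twisted i n.+2 h = sw h (fun a c => lfpow tau i a * conv_twisted i.+1 n.+1 c) by [].
have l := lin_conv_twisted Hs tau i.+1 n.+1; rewrite (@sw_comp _ _ _ _ _ (mcoef x y)); last by lin_tac.
transitivity (sw h (fun a c => \sum_s \sum_(zs : n.-tuple 'I_d)
    (mcoef x s (lfpow tau i a) : K) *: tcoef i.+1 (s :: zs) (rcons zs y) c)).
  apply: eq_swK => a c; rewrite mcoefM; apply: eq_bigr => s _.
  by rewrite IHn; exact: mulr_sumr.
by rewrite big_tuple_cons -(@sum_sw K H Hs K^o); apply: eq_bigr => s _; rewrite -(@sum_sw K H Hs K^o).
Qed.

Lemma tcoef_rcons n i (xs ys : seq 'I_d) x y h : size xs = n -> size ys = n ->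
  tcoef i (rcons xs x) (rcons ys y) h =
  sw h (fun a c => (tcoef i xs ys a : K) *: mcoef x y (lfpow tau (i + n) c)).
Proof.
elim: n i xs ys h => [|n IHn] i [|x0 xs] [|y0 ys] h //= => [_ _|[sx] [sy]].
  transitivity (mcoef x y (lfpow tau i h)).
    rewrite -[RHS](sw_counitr Hs (f := fun a => mcoef x y (lfpow tau i a))); last by lin_tac.
    by apply: eq_swK => a c; exact: mulrC.
  rewrite addn0.
  by rewrite (sw_counitl _ (f := fun a => mcoef x y (lfpow tau i a))) //; lin_tac.
have l := lin_tcoef i.+1 xs ys.
under eq_sw => a c.
  rewrite IHn // (@sw_comp _ _ _ _ _ (fun w : K^o => (mcoef x0 y0 (lfpow tau i a) : K) *: w)); last by lin_tac.
  over.
rewrite -(sw_coassoc _ (f := fun a c e => (mcoef x0 y0 (lfpow tau i a) : K) *: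
  ((tcoef i.+1 xs ys c : K) *: mcoef x y (lfpow tau (i.+1 + n) e)))); last by tlin.
apply: eq_swK => a e.
rewrite (@sw_comp _ _ _ _ _ (fun w : K^o => (w : K) *: mcoef x y (lfpow tau (i + n.+1) e))); last by lin_tac.
by apply: eq_swK => p q; rewrite scalerA addSnnS.
Qed.

Lemma tcoef_shift i xs ys h : tcoef i.+1 xs ys h = tcoef i xs ys (tau h).
Proof.
elim: xs ys i h => [|x xs IHxs] [|y ys] i h //=; first by rewrite auto_counit.
have l := lin_tcoef i.+1 xs ys; rewrite (sw_auto tauP); last by blin.
by apply: eq_swK => a c; rewrite IHxs comp_lfunE.
Qed.

(** Rotation exchanges the two parts of L by [int_cocomm]; replacing L by tau(L) corrects the
    twists, the moved factor receiving tau^n = id. *)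
Lemma tcoef_rot n (xs ys : n.-tuple 'I_d) : (r %| n)%N ->
  tcoef 0 (rot 1 xs) (rot 1 ys) L = tcoef 0 xs ys L.
Proof.
case: n xs ys => [|n] xs ys rn; first by rewrite [xs]tuple0 [ys]tuple0.
case/tupleP: xs => x xs; case/tupleP: ys => y ys.
rewrite !rot1_cons (@tcoef_rcons n) ?size_tuple // add0n -{1}(auto_int tauP LP).
have l := lin_tcoef 0 xs ys; have l1 := lin_tcoef 1 xs ys.
rewrite (sw_auto tauP); last by blin.
pose phi : 'Hom(H, K^o) := linfun (tcoef 1 xs ys).
have phiE h : phi h = tcoef 1 xs ys h by rewrite linfunE.
transitivity (sw L (fun a c => (phi a : K) *: mcoef x y c)).
  apply: eq_swK => a c; rewrite phiE tcoef_shift; congr (_ *: mcoef x y _).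
  by rewrite -[RHS](iter_auto tau_r c rn) !lfpowE iterSr.
rewrite (int_cocomm charK ssH LP) /=.
apply: eq_swK => a c; rewrite phiE /lfpow /= id_lfunE; exact: mulrC.
Qed.

Section Matrix.
Variables (n : nat) (rn : (r %| n)%N).
Local Notation T := (n.-tuple 'I_d).
Local Notation rt z := ([tuple of rot 1 z] : T).

Local Notation ev i := (enum_val (i : 'I_#|{: T}|) : T).

(* The action of the integral on V (x) V^tau (x) ... followed by the cyclic shift. *)
Definition cyclic_mx : 'M[K]_#|{: T}| :=
  \matrix_(i, j) tcoef 0 (ev i) (rt (ev j)) L.

Lemma tcoef_int_idem (xs ys : T) :
  \sum_(zs : T) (tcoef 0 xs zs L : K) * tcoef 0 zs ys L = tcoef 0 xs ys L.
Proof. by rewrite -tcoefM (int_l LP) int1 // scale1r. Qed.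

Lemma rt_inj : injective (fun z : T => rt z).
Proof. by move=> x y /(congr1 val) /= /rot_inj/val_inj. Qed.

Lemma cyclic_mx_pow k i j :
  mxpow cyclic_mx k.+1 i j = tcoef 0 (ev i) (iter k.+1 (fun z : T => rt z) (ev j)) L.
Proof.
elim: k i j => [|k IHk] i j; first by rewrite /mxpow /= mulmx1 mxE.
rewrite /mxpow iterS -/(mxpow _ _) mxE.
under eq_bigr => s _ do rewrite IHk mxE.
rewrite -(reindex (fun z : 'I_#|{: T}| => ev z)
  (P := predT) (F := fun z : T => (tcoef 0 (ev i) (rt z) L : K) * tcoef 0 z (iter k.+1 (fun z : T => rt z) (ev j)) L)).
  rewrite -tcoef_int_idem [RHS](reindex (fun z : T => rt z)) /=.
    apply: eq_bigr => z _; congr (_ * _).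
    exact: (esym (tcoef_rot z (iter k.+1 (fun z : T => rt z) (ev j)) rn)).
  by exists (invF rt_inj) => z _; [exact: (invF_f rt_inj) | exact: (f_invF rt_inj)].
by exists enum_rank => z _; [exact: enum_valK | exact: enum_rankK].
Qed.

Lemma iter_rt (z : T) : iter n (fun z : T => rt z) z = z.
Proof.
apply: val_inj; have E k : (k <= n)%N -> val (iter k (fun z : T => rt z) z) = rot k z.
  elim: k => [|k IHk] kn; first by rewrite rot0.
  by rewrite iterS /= [X in rot 1 X](IHk (ltnW kn)) -rotS ?size_tuple.
by rewrite E // rot_oversize ?size_tuple.
Qed.

(** In this form the eigenvalue 0, from the kernel of L, is permitted beside the n-th roots of
    unity. *)
Lemma cyclic_mx_period : (0 < n)%N -> mxpow cyclic_mx n.+1 = cyclic_mx.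
Proof.
move=> n0; apply/matrixP => i j; rewrite cyclic_mx_pow iterS iter_rt mxE.
by [].
Qed.

End Matrix.

Lemma trace_cyclic_mx n :
  \tr (cyclic_mx n.+1) = character rho (conv_twisted 0 n.+1 L).
Proof.
rewrite /mxtrace.
under eq_bigr => i _ do rewrite mxE.
rewrite -(reindex (fun z : 'I_#|{: n.+1.-tuple 'I_d}| => (enum_val z : n.+1.-tuple 'I_d))
  (P := predT) (F := fun z : n.+1.-tuple 'I_d => tcoef 0 z (rot 1 z) L)).
  rewrite big_tuple_cons /character traceE; apply: eq_bigr => x _.
  rewrite -mcoefE tcoef_conv_twisted; apply: eq_bigr => zs _.
  by rewrite /= rot1_cons.
by exists enum_rank => z _; [exact: enum_valK | exact: enum_rankK].
Qed.

End Coefficients.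

(** * Integrality of the indicators *)

(** A prime dividing both d / g and m, for g = gcd(d, m), also divides g, so its square divides
    d. *)
Lemma squarefree_large d m : (0 < d)%N -> squarefree d -> large_compared m d.
Proof.
move=> d0 sqf; rewrite /large_compared; set g := gcdn d m.
have gd : (g %| d)%N by apply: dvdn_gcdl.
have q0 : (0 < d %/ g)%N by rewrite divn_gt0 ?gcdn_gt0 ?d0 // dvdn_leq.
rewrite /coprime eqn_leq gcdn_gt0 q0 andbT leqNgt; apply/negP => /pdiv_prime; set p := pdiv _ => p_pr.
have pg1 : (p %| gcdn (d %/ g) m)%N by apply: pdiv_dvd.
have pq : (p %| d %/ g)%N := dvdn_trans pg1 (dvdn_gcdl _ _).
have pm : (p %| m)%N := dvdn_trans pg1 (dvdn_gcdr _ _).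
have pg : (p %| g)%N by rewrite dvdn_gcd pm andbT -(divnK gd) dvdn_mulr.
by have /negP[] := sqf p p_pr; rewrite -(divnK gd) dvdn_mul.
Qed.

Lemma squarefree_dvd a b : (a %| b)%N -> squarefree b -> squarefree a.
Proof. by move=> ab sqf p /sqf; apply: contra => /dvdn_trans; apply. Qed.

Lemma lfpow_eigen (K : fieldType) (U : vectType K) (f : 'End(U)) c v k :
  f v = c *: v -> lfpow f k v = c ^+ k *: v.
Proof.
move=> fv; rewrite lfpowE; elim: k => [|k IHk]; first by rewrite scale1r.
by rewrite iterS IHk linearZ /= fv scalerA -exprSr.
Qed.

Lemma mxpow_eigen (K : fieldType) n (A : 'M[K]_n) c (v : 'rV_n) k :
  v *m A = c *: v -> v *m mxpow A k = c ^+ k *: v.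
Proof.
move=> vA; elim: k => [|k IHk]; first by rewrite mulmx1 scale1r.
by rewrite /mxpow iterS mulmxA vA -scalemxAl -/(mxpow A k) IHk scalerA -exprS.
Qed.

Section Indicator.
Variables (K : closedFieldType) (charK : [pchar K] =i pred0).
Variables (H : falgType K) (Hs : hopf_algebra H) (ssH : semisimple H).
Variables (L : H) (LP : normalized_integral Hs L).
Variables (tau : 'End(H)) (tauP : hopf_automorphism Hs tau).
Variables (r : nat) (r_gt0 : (0 < r)%N) (tau_r : forall h, iter r tau h = h).
Variables (V : vectType K) (rho : 'Hom(H, 'End(V))) (rhoP : representation rho).
Local Notation F := (twisted_op Hs (lfpow tau r.-1) rho).

Lemma indicator_int k m : (0 < k)%N ->
    (forall x, lfpow F (r * k) x = x) -> (0 < m)%N -> (r %| m)%N ->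
    large_compared m (r * k) ->
  exists z : int, indicator Hs L m (character rho) tau = z%:~R.
Proof.
move=> k0 Fk m0 rm large.
rewrite /indicator twisted_powerE //; set d := (r * k)%N in Fk large.
have d0 : (0 < d)%N by rewrite muln_gt0 r_gt0.
pose g := gcdn d m.
have [s [_ trs eigs]] := mx_spectrum (cyclic_mx Hs L tau rho m).
have [q [_ trq eigq]] := lfun_spectrum F.
apply: (@sum_unity_roots_int K charK m (d %/ g) (\dim {:H}) _ s [seq c ^+ m | c <- q]) => //.
- by rewrite divn_gt0 ?gcdn_gt0 ?d0 // dvdn_leq // dvdn_gcdl.
- rewrite lt0n dimv_eq0 -subv0; apply/negP => /subvP/(_ 1 (memvf _)).
  by rewrite memv0 oner_eq0.
- by rewrite coprime_sym.
- move=> c /eigs/eigenvalueP[v vc v0].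
  have := mxpow_eigen m.+1 vc; rewrite (cyclic_mx_period charK ssH LP tauP tau_r) // vc.
  move=> /eqP; rewrite -subr_eq0 -scalerBl scaler_eq0 (negPf v0) orbF.
  rewrite exprS -{1}[c]mulr1 -mulrBr mulf_eq0 subr_eq0 eq_sym => /orP[]/eqP.
    by left.
  by right.
- move=> _ /mapP[c /eigq[v v0 vc] ->].
  have := lfpow_eigen d vc; rewrite Fk => /eqP.
  rewrite -{1}[v]scale1r -subr_eq0 -scalerBl scaler_eq0 (negPf v0) orbF.
  rewrite subr_eq0 eq_sym => /eqP cd.
  (* The exponent m (d / g) equals d (m / g). *)
  rewrite -exprM muln_divA ?dvdn_gcdl // mulnC -muln_divA ?dvdn_gcdr //.
  by rewrite exprM cd expr1n.
- rewrite -[RHS](trs 1%N) /mxpow /= mulmx1; case: (m) m0 => // m' _.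
  by rewrite trace_cyclic_mx.
by rewrite -(trace_twisted_op charK ssH LP tauP r_gt0 tau_r rhoP) // trq big_map.
Qed.

End Indicator.

Theorem theorem4p3 (K : closedFieldType) (charK : [pchar K] =i pred0)
    (H : falgType K) (Hs : hopf_algebra H) (ssH : semisimple H)
    (tau : 'End(H)) (tauP : hopf_automorphism Hs tau)
    (r : nat) (tau_r : automorphism_order tau (Some r))
    (L : H) (LP : normalized_integral Hs L)
    (V : vectType K) (rho : 'Hom(H, 'End(V))) (rhoP : representation rho)
    (k : nat) (expV : module_exponent Hs tau r rho (Some k)) :
  let chi := character rho in
  let dV := (r * k)%N in
  [/\ (* (1) *)
      forall m : nat, (0 < m)%N -> (r %| m)%N -> large_compared m dV ->
        exists z : int, indicator Hs L m chi tau = z%:~R,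
      (* (2) *)
      squarefree dV ->
        forall m : nat, (0 < m)%N -> (r %| m)%N ->
        exists z : int, indicator Hs L m chi tau = z%:~R &
      forall kH : nat, algebra_exponent Hs tau r (Some kH) ->
        squarefree (r * kH)%N ->
        squarefree dV /\
        forall m : nat, (0 < m)%N -> (r %| m)%N ->
        exists z : int, indicator Hs L m chi tau = z%:~R].
Proof.
move=> chi dV; have [r0 taur _] := tau_r.
move: expV; rewrite /module_exponent (sigma_twist_id charK ssH LP) => -[k0 rhok kmin].
pose F := twisted_op Hs (lfpow tau r.-1) rho.
have FP j : (0 < j)%N ->
    (forall h, rho (twisted_power Hs tau (j * r) h) = (counit Hs h : K) *: \1%VF) <->
    (forall x, lfpow F (r * j) x = x).
  move=> j0; rewrite mulnC -(twisted_op_id tauP r0 taur rhoP) ?dvdn_mulr //.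
  by split=> E h; have := E h; rewrite twisted_powerE ?muln_gt0 ?r0.
have Fk := (FP k k0).1 rhok.
have int_m m : (0 < m)%N -> (r %| m)%N -> large_compared m dV ->
    exists z : int, indicator Hs L m chi tau = z%:~R.
  exact: (indicator_int charK ssH LP tauP r0 taur rhoP k0 Fk).
have dV0 : (0 < dV)%N by rewrite muln_gt0 r0.
have int_sqf : squarefree dV -> forall m : nat, (0 < m)%N -> (r %| m)%N ->
    exists z : int, indicator Hs L m chi tau = z%:~R.
  by move=> sqf m m0 rm; apply: int_m => //; apply: squarefree_large.
split=> // kH; rewrite /algebra_exponent (sigma_twist_id charK ssH LP) => -[kH0 expH _] sqf.
suff sqfV : squarefree dV by split=> //; apply: int_sqf.
apply: squarefree_dvd sqf; rewrite dvdn_pmul2l //.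
have FkH : forall x, lfpow F (r * kH) x = x.
  by apply/(FP kH kH0) => h; rewrite expH linearZ /= rhoP.1.
(* The j with F^(r j) = 1 are closed under gcd, so minimality of k forces k to divide [kH]. *)
suff Fg : forall x, lfpow F (r * gcdn k kH) x = x.
  have g0 : (0 < gcdn k kH)%N by rewrite gcdn_gt0 k0.
  have := kmin _ g0 ((FP _ g0).2 Fg) => kg.
  by apply/gcdn_idPl/eqP; rewrite eqn_leq kg dvdn_leq ?dvdn_gcdl.
have iterM n j x : (forall y, lfpow F n y = y) -> iter (j * n) F x = x.
  move=> Fn; elim: j => // j IHj; by rewrite mulSn iterD IHj -lfpowE Fn.
move=> x; case: (egcdnP kH k0) => a b ab _.
have := iterM _ a x Fk; rewrite mulnCA ab mulnDr addnC iterD mulnCA.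
by rewrite (iterM _ b x FkH) -lfpowE.
Qed.
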